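(* Let $M$ be a smooth manifold, $(h,X)$ a Morse–Smale pair on $M$, and $v,w\in\mathrm{Crit}(h)$ arbitrary critical points with $w<v$. Then: (i) $\mathcal B(v,w)$ is a compact Hausdorff space. (ii) $\hat W^-_v$ is a Hausdorff space, and both $\hat i_v:\hat W^-_v\to M$ and $\hat h_v:=h\circ\hat i_v:\hat W^-_v\to\mathbb R$ are proper continuous maps. In particular, if in addition $M$ is compact, then so is $\hat W^-_v$.
   Context: **Morse–Smale pair.** Let $M$ be a smooth $n$-dimensional manifold without boundary and $h:M\to\mathbb R$ a smooth Morse function; $i(v)$ is the index of $v\in\mathrm{Crit}(h)$. A smooth vector field $X$ is gradient-like with respect to $h$ if (GL1) $X(h)(x)<0$ for all $x\in M\setminus\mathrm{Crit}(h)$, and (GL2) for each $v\in\mathrm{Crit}(h)$ there are an open neighborhood $U_v$ of $v$ and a coordinate map (diffeomorphism) $\varphi_v:B_r\to U_v$ from the open ball $B_r\subset\mathbb R^n$ of some radius $r=r(v)>0$ about $0$ with $h\circ\varphi_v(x)=h(v)-\frac12\sum_{j\le i(v)}x_j^2+\frac12\sum_{j>i(v)}x_j^2$ and $\varphi_v^*X=\sum_{j\le i(v)}x_j\partial_{x_j}-\sum_{j>i(v)}x_j\partial_{x_j}$. $X$ is assumed complete, with flow $\Phi_t$. Put $W^\pm_v=\{x\in M:\lim_{t\to\pm\infty}\Phi_t(x)=v\}$ (submanifolds of $M$). $(h,X)$ is a Morse–Smale pair if $h$ is a smooth proper Morse function, $X$ is gradient-like with respect to $h$, and $W^-_v$ and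 $W^+_w$ intersect transversally for all $v,w\in\mathrm{Crit}(h)$. **Trajectories.** For $v\ne w$, $\mathcal T(v,w)=(W^-_v\cap W^+_w)/\mathbb R$, the quotient by the flow. Write $w<v$ iff $i(w)<i(v)$ and $h(w)<h(v)$; $w\le v$ iff $w<v$ or $w=v$. For $w<v$, $\mathcal B(v,w)=\bigcup_{w<v_\ell<\dots<v_1<v}\mathcal T(v,v_1)\times\dots\times\mathcal T(v_\ell,w)$ (union over all finite, possibly empty, chains of critical points), and $\mathcal B(v,v)=\{v\}$. $\hat W^-_v=\bigcup_{w\le v}\mathcal B(v,w)\times W^-_w$ (disjoint union), and $\hat i_v:\hat W^-_v\to M$ is, on $\mathcal B(v,w)\times W^-_w$, the projection to $W^-_w$ followed by the inclusion into $M$. Each $\gamma\in\mathcal B(v,w)$ is identified with the continuous path $\gamma:[h(w),h(v)]\to M$ along the (broken) trajectory with $h(\gamma(s))=s$; each $(\gamma,x)\in\hat W^-_v$ is identified with the analogous path $\gamma_x:[h(x),h(v)]\to M$ from $v$ to $x$, $h(\gamma_x(s))=s$. **Topology of $\mathcal B(v,w)$.** The critical values of $h$ are listed in decreasing order $\dots<c_{j+1}<c_j<c_{j-1}<\dots$. Let $h(v)=c_k$, $h(w)=c_m$, and $\varepsilon>0$ so small that $c_j-2\varepsilon>c_{j+1}$ for the relevant $j$; $M^-_{j,\varepsilon}=h^{-1}(c_j-\varepsilon)$. The map $J_\varepsilon:\mathcal B(v,w)\to M^-_{k,\varepsilon}\times\dots\times M^-_{m-1,\varepsilon}$, $\gamma\mapsto(\gamma(c_k-\varepsilon),\dots,\gamma(c_{m-1}-\varepsilon))$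 is injective; $\mathcal B(v,w)$ carries the topology making $J_\varepsilon$ a homeomorphism onto its image (independent of $\varepsilon$). **Topology of $\hat W^-_v$.** Let $h(v)=c_k$. For $j\ge k$ choose $0<\delta_j<\frac12\min(c_j-c_{j+1},c_{j-1}-c_j)$ and put $\hat W^-_{v,j}=\hat h_v^{-1}([c_{j+1}+\delta_j,c_{j-1}-\delta_j])$. (If there is no critical value below, resp. above, $c_j$, set $c_{j+1}=-\infty$, resp. $c_{j-1}=+\infty$.) The injective map $\hat J_{\varepsilon,j}:\hat W^-_{v,j}\to M^-_{k,\varepsilon}\times\dots\times M^-_{j-1,\varepsilon}\times h^{-1}([c_{j+1}+\delta_j,c_{j-1}-\delta_j])$, $(\gamma,x)\mapsto(\gamma_x(c_k-\varepsilon),\dots,\gamma_x(c_{j-1}-\varepsilon),x)$, defines a topology on $\hat W^-_{v,j}$ by identification with its image; if $h(x)>c_{j-1}-\varepsilon$, then $\gamma_x$ is prolonged by the forward trajectory of $X$ through $x$ down to the level $c_{j-1}-\varepsilon$. These topologies do not depend on $\varepsilon$. $\hat W^-_v=\bigcup_{j\ge k}\hat W^-_{v,j}$ carries the topology in which a set is closed iff its intersection with each $\hat W^-_{v,j}$ is closed in $\hat W^-_{v,j}$ (independent of the $\delta_j$). *)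

(* Defs.v *)
From HB Require Import structures.
From mathcomp Require Import all_boot all_order all_algebra.
From mathcomp Require Import all_classical all_reals all_analysis.

Set Implicit Arguments.
Unset Strict Implicit.
Unset Printing Implicit Defensive.

Import Order.TTheory GRing.Theory Num.Theory.
Import numFieldNormedType.Exports.

Local Open Scope classical_set_scope.
Local Open Scope ring_scope.

(** * Smooth maps *)

Section smooth.
Context {R : realType} {V W : normedModType R}.

(* Meant for [U] open and [V], [W] finite-dimensional: iterated directional
   derivatives exist and are continuous on [U] up to order [k]. *)
Fixpoint Ck (k : nat) (U : set V) (f : V -> W) : Prop :=
  (forall x, U x -> {for x, continuous f}) /\
  if k is k'.+1 then
    forall u : V, (forall x, U x -> derivable f x u) /\ Ck k' U ('D_u f)
  else True.

Definition smooth_on (U : set V) (f : V -> W) := forall k, Ck k U f.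

End smooth.

(** * Smooth manifolds (without boundary) *)

(* [cfun] and [cinv] are total functions, meaningful on [cdom], resp. [ccod]. *)
Record chart (R : realType) (n : nat) (M : topologicalType) := Chart {
  cdom : set M;
  ccod : set 'rV[R]_n;
  cfun : M -> 'rV[R]_n;
  cinv : 'rV[R]_n -> M }.

Section charts.
Context {R : realType} {n : nat} {M : topologicalType}.
Implicit Types c d : chart R n M.

Definition is_chart c : Prop :=
  [/\ open (cdom c) /\ open (ccod c),
      forall x, cdom c x -> ccod c (cfun c x) /\ cinv c (cfun c x) = x,
      forall y, ccod c y -> cdom c (cinv c y) /\ cfun c (cinv c y) = y,
      forall x, cdom c x -> {for x, continuous (cfun c)} &
      forall y, ccod c y -> {for y, continuous (cinv c)}].

Definition smooth_transition c d : Prop :=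
  smooth_on [set y | ccod c y /\ cdom d (cinv c y)] (cfun d \o cinv c).

Definition compatible c d : Prop := smooth_transition c d /\ smooth_transition d c.

End charts.

(* The charts [chart_at x] form the atlas. *)
Record manifold (R : realType) (n : nat) := Manifold {
  mcarrier :> topologicalType;
  mhausdorff : hausdorff_space mcarrier;
  msecond_countable : @second_countable mcarrier;
  chart_at : mcarrier -> chart R n mcarrier;
  chart_atP : forall x, is_chart (chart_at x);
  chart_at_dom : forall x, cdom (chart_at x) x;
  chart_at_compatible : forall x y, compatible (chart_at x) (chart_at y) }.

Section calculus.
Context {R : realType} {n : nat} {M : manifold R n}.

(* The tangent space at [x] is ['rV[R]_n], through the coordinates
   [chart_at x]; [coord_vec c x u] is the coordinate vector in the chart [c] of
   the tangent vector [u] at [x]. *)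
Definition coord_vec (c : chart R n M) (x : M) (u : 'rV[R]_n) : 'rV[R]_n :=
  'D_u (cfun c \o cinv (chart_at x)) (cfun (chart_at x) x).

Definition smooth_function (h : M -> R) : Prop :=
  forall p : M, smooth_on (ccod (chart_at p)) (h \o cinv (chart_at p) : _ -> R^o).

Definition smooth_field (X : M -> 'rV[R]_n) : Prop :=
  forall p : M, smooth_on (ccod (chart_at p))
    (fun y => let x := cinv (chart_at p) y in coord_vec (chart_at p) x (X x)).

Definition dfun (h : M -> R) (x : M) (u : 'rV[R]_n) : R :=
  'D_u (h \o cinv (chart_at x) : _ -> R^o) (cfun (chart_at x) x).

(* Velocities at [x] of smooth curves in [S]: this is the tangent space of [S]
   at [x] when [S] is a submanifold. *)
Definition tangent (S : set M) (x : M) : set 'rV[R]_n := [set u |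
  exists (e : R) (g : R -> M), let g' : R^o -> 'rV[R]_n := cfun (chart_at x) \o g in
    [/\ 0 < e, g 0 = x,
        forall t, `|t| < e -> S (g t) /\ cdom (chart_at x) (g t),
        smooth_on [set t : R^o | `|t| < e] g' &
        'D_(1 : R^o) g' 0 = u]].

Definition transverse (S T : set M) : Prop :=
  forall x, S x -> T x ->
    forall u, exists a b, [/\ tangent S x a, tangent T x b & u = a + b].

End calculus.

(* The global flow generated by the complete vector field [X]: a smooth action
   of the group R on [M] with infinitesimal generator [X]. *)
Definition is_flow {R : realType} {n : nat} {M : manifold R n}
    (X : M -> 'rV[R]_n) (Phi : R -> M -> M) : Prop :=
  [/\ forall x, Phi 0 x = x,
      forall s t x, Phi (s + t) x = Phi s (Phi t x),
      continuous (fun z : R * M => Phi z.1 z.2),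
      forall p q : M, smooth_on
        [set z : R^o * 'rV[R]_n | ccod (chart_at p) z.2 /\
           cdom (chart_at q) (Phi z.1 (cinv (chart_at p) z.2))]
        (fun z => cfun (chart_at q) (Phi z.1 (cinv (chart_at p) z.2))) &
      forall t x, is_derive (t : R^o) (1 : R^o)
        (fun s => cfun (chart_at (Phi t x)) (Phi s x)) (X (Phi t x))].

Definition proper_map {S T : topologicalType} (f : S -> T) : Prop :=
  forall K : set T, compact K -> compact (f @^-1` K).

(** * Morse-Smale pairs *)

Section morse.
Context {R : realType} {n : nat} {M : manifold R n}.
Variable h : M -> R.

Definition Crit : set M := [set x | forall u, dfun h x u = 0].

Definition hessian (x : M) : 'M[R]_n := \matrix_(i, j)
  'D_(delta_mx 0 i) ('D_(delta_mx 0 j) (h \o cinv (chart_at x) : _ -> R^o))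
    (cfun (chart_at x) x).

Definition morse : Prop :=
  smooth_function h /\ forall v, Crit v -> hessian v \in unitmx.

Definition has_negdef_subspace (H : 'M[R]_n) (k : nat) : Prop :=
  exists A : 'M[R]_(k, n), row_free A /\
    forall u : 'rV[R]_k, u != 0 -> ((u *m A) *m H *m (u *m A)^T) 0 0 < 0.

Definition morse_index (v : M) : nat :=
  (\max_(k < n.+1 | `[< has_negdef_subspace (hessian v) k >]) k)%N.

(* The library norm on row vectors is the sup norm, hence this Euclidean ball. *)
Definition eball (r : R) : set 'rV[R]_n :=
  [set y | \sum_(j < n) y 0 j ^+ 2 < r ^+ 2].

(* The coordinate map of (GL2) is [cinv c], its image [cdom c]. *)
Definition gradient_like (X : M -> 'rV[R]_n) : Prop :=
  [/\ smooth_field X,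
      forall x, ~ Crit x -> dfun h x (X x) < 0 &
      forall v, Crit v -> exists (r : R) (c : chart R n M),
        [/\ 0 < r /\ ccod c = eball r,
            is_chart c /\ (forall p, compatible c (chart_at p)),
            cdom c v,
            forall y, eball r y -> h (cinv c y) = h v
              - 2^-1 * (\sum_(j < n | (j < morse_index v)%N) y 0 j ^+ 2)
              + 2^-1 * (\sum_(j < n | (morse_index v <= j)%N) y 0 j ^+ 2) &
            forall y, eball r y -> coord_vec c (cinv c y) (X (cinv c y)) =
              \row_j (if (j < morse_index v)%N then y 0 j else - y 0 j)]].

Variables (X : M -> 'rV[R]_n) (Phi : R -> M -> M).

Definition Wminus (v : M) : set M := [set x | Phi t x @[t --> -oo] --> v].
Definition Wplus (v : M) : set M := [set x | Phi t x @[t --> +oo] --> v].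

Definition morse_smale : Prop :=
  [/\ morse, proper_map (h : M -> R^o), gradient_like X &
      forall v w, Crit v -> Crit w -> transverse (Wminus v) (Wplus w)].

(** * Broken trajectories *)

Definition crit_lt (w v : M) : Prop := (morse_index w < morse_index v)%N /\ h w < h v.
Definition crit_le (w v : M) : Prop := crit_lt w v \/ w = v.

Definition flow_orbit (x : M) : set M := range (Phi ^~ x).

Definition Traj (v w : M) : set (set M) :=
  [set o | exists2 x, (Wminus v `&` Wplus w) x & o = flow_orbit x].

(* A point of T(v,v_1) x ... x T(v_l,w) is encoded as the list
   [:: (o_0, v_1); ...; (o_l, w)] of trajectories with their lower ends; the
   point of B(v,v) is the empty list. *)
Fixpoint broken (v w : M) (s : seq (set M * M)) : Prop :=
  if s is (o, u) :: s' then
    [/\ Crit u, crit_lt u v, Traj v u o & broken u w s']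
  else v = w.

Definition B (v w : M) : set (seq (set M * M)) := [set s | broken v w s].

Fixpoint path_trace (v : M) (s : seq (set M * M)) : set M :=
  if s is (o, u) :: s' then [set v] `|` o `|` path_trace u s' else [set v].

(* gamma(s): the only point of the broken trajectory at level s *)
Definition path_at (v : M) (g : seq (set M * M)) (s : R) : M :=
  xget v (path_trace v g `&` [set y | h y = s]).

(* The list of critical values is indexed by the values themselves: for
   h(v) = c_k and h(w) = c_m, the values c_k, ..., c_{m-1} are the elements of
   [crit_levels (h w) (h v)]. *)
Definition crit_value : set R := h @` Crit.

Definition crit_levels (lo hi : R) : set R :=
  [set c | crit_value c /\ lo < c <= hi].

(* [d] is the critical value just below [c] *)
Definition next_below (d c : R) : Prop :=
  [/\ crit_value d, crit_value c, d < c &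
      forall e, crit_value e -> ~~ (d < e < c)].

Definition eps_small (lo hi eps : R) : Prop :=
  0 < eps /\ forall c d, crit_levels lo hi c -> next_below d c -> d < c - 2 * eps.

Definition J (eps : R) (v w : M) (g : set_type (B v w)) :
    prod_topology (fun _ : set_type (crit_levels (h w) (h v)) => M : topologicalType) :=
  fun c => path_at v (set_val g) (set_val c - eps).

Definition Bspace (eps : R) (v w : M) : topologicalType :=
  initial_topology (@J eps v w).

(** * The space \hat W^-_v *)

Record hatW (v : M) := HatW {
  hw_end : M;
  hw_crit : Crit hw_end;
  hw_le : crit_le hw_end v;
  hw_path : set_type (B v hw_end);
  hw_pt : set_type (Wminus hw_end) }.

HB.instance Definition _ v := gen_eqMixin (hatW v).
HB.instance Definition _ v := gen_choiceMixin (hatW v).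

Definition hat_i (v : M) (p : hatW v) : M := set_val (hw_pt p).
Definition hat_h (v : M) : hatW v -> R := h \o @hat_i v.

(* gamma_x(s); for s < h(x), its prolongation by the forward trajectory *)
Definition hat_path_at (v : M) (p : hatW v) (s : R) : M :=
  let x := hat_i p in
  if h x <= s then
    xget v ((path_trace v (set_val (hw_path p)) `|` [set Phi t x | t in [set t | t <= 0]])
            `&` [set y | h y = s])
  else xget v ([set Phi t x | t in [set t | 0 <= t]] `&` [set y | h y = s]).

(* [c_{j+1} + delta_j, c_{j-1} - delta_j] for c = c_j *)
Definition band (c del : R) : set R :=
  [set s | (forall d, next_below d c -> d + del <= s) /\
           (forall d, next_below c d -> s <= d - del)].

Definition delta_small (c del : R) : Prop :=
  [/\ 0 < del, forall d, next_below d c -> del < (c - d) / 2 &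
      forall d, next_below c d -> del < (d - c) / 2].

Definition hatW_band (v : M) (del c : R) : set (hatW v) :=
  hat_h (v := v) @^-1` band c del.

Definition hatJ (eps del : R) (v : M) (c : R)
    (p : set_type (@hatW_band v del c)) :
    prod_topology (fun _ : set_type (crit_levels c (h v)) => M : topologicalType) * M :=
  (fun d => hat_path_at (set_val p) (set_val d - eps), hat_i (set_val p)).

(* \hat W^-_{v,j}, with c = c_j *)
Definition hatW_part (eps del : R) (v : M) (c : R) : topologicalType :=
  initial_topology (@hatJ eps del v c).

(* [eps] and [del] give the constants used for each critical value. *)
Definition hatWspace (eps del : R -> R) (v : M) : Type := hatW v.

Section hatW_topology.
Variables (eps del : R -> R) (v : M).
Local Notation W := (hatWspace eps del v).

HB.instance Definition _ := Choice.copy W (hatW v).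

(* The topology coherent with the pieces [hatW_part], given by its open sets. *)
Definition hatW_open (A : set W) : Prop :=
  forall c, crit_value c -> c <= h v ->
    open ((fun p : set_type (@hatW_band v (del c) c) => set_val p) @^-1` A
          : set (hatW_part (eps c) (del c) v c)).

Fact hatW_openT : hatW_open setT.
Proof. by move=> c _ _; exact: openT. Qed.

Fact hatW_openI : setI_closed hatW_open.
Proof. by move=> A A' oA oA' c cc cv; apply: openI; [exact: oA|exact: oA']. Qed.

Fact hatW_open_bigU (I : Type) (f : I -> set W) :
  (forall i, hatW_open (f i)) -> hatW_open (\bigcup_i f i).
Proof.
move=> oF c cc cv; rewrite preimage_bigcup.
by apply: bigcup_open => i _; exact: oF.
Qed.

HB.instance Definition _ :=
  isOpenTopological.Build W hatW_openT hatW_openI hatW_open_bigU.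

End hatW_topology.

Definition hatW_constants (eps del : R -> R) (v : M) : Prop :=
  forall c, crit_value c -> c <= h v ->
    eps_small c (h v) (eps c) /\ delta_small c (del c).

End morse.

(* Main.v *)
Require Import Defs.
From HB Require Import structures.
From mathcomp Require Import all_boot all_order all_algebra.
From mathcomp Require Import all_classical all_reals all_analysis.
From mathcomp Require Import ring lra zify.
Import Order.TTheory GRing.Theory Num.Theory.
Import numFieldNormedType.Exports.
Local Open Scope classical_set_scope.
Local Open Scope ring_scope.

Set Implicit Arguments.
Unset Strict Implicit.
Unset Printing Implicit Defensive.

(** Only three properties of a Morse-Smale pair matter: [h] strictly decreases
    along the flow off the critical set, critical points are fixed and isolated,
    and a trajectory from [v] to [w <> v] lowers the index.  The last one comes
    from transversality: the tangent spaces of W^-_v and W^+_w span, they lie in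
    spaces of dimension [i(v)] and [n - i(w)], and both contain [X].

    Say that [y] is linked to [x] if it lies below [x] on a trajectory broken at
    most once.  Over an interval with at most one critical value this relation is
    closed: a limit of trajectories either is reached in bounded time, or runs
    into a critical point and comes out of one; these two points agree, because
    leaving a neighbourhood of a critical point costs a definite amount of [h].
    The images of [J] and [hatJ] are cut out of a compact product of level sets
    by finitely many linkage conditions, hence are compact.  For the Hausdorff
    property, points of W-hat with the same end point are told apart by the
    point of their path at a noncritical level; by flowing along [X], this point
    depends continuously on the path, on the open part of W-hat below the level. *)

(** * Flows with a Lyapunov function *)

(** The record [lyapunov_flow] is invariant under reversing time and replacing [h] by [- h], so
    results on stable sets yield those on unstable sets.

    Closedness of linkage is stated for intervals with one critical value, not one critical point:
    distinct critical points may share a level, and the main difficulty is to exclude a limit that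
    runs into one of them and comes out of another. Over longer intervals closedness fails, since a
    limit may break several times.

    A limit only yields a chain of orbits along which [h] decreases, whereas consecutive vertices of
    a point of B(v, w) must also have decreasing indices. This is where transversality enters.

    The topology of W-hat is coherent with the bands and not induced by one embedding. As the
    constants [del] are smaller than half the gaps between critical values, every level up to [h v]
    is interior to some band. An ultrafilter on a slab selects one level, and compactness is then
    decided inside a single band. *)

Record lyapunov_flow {R : realType} {M : topologicalType} (h : M -> R)
    (Phi : R -> M -> M) (C : set M) : Prop := LyapunovFlow {
  lyap_hausdorff : hausdorff_space M;
  lyap_continuous : continuous h;
  lyap_proper : forall a b, compact [set x | a <= h x <= b];
  flow0 : forall x, Phi 0 x = x;
  flowD : forall s t x, Phi (s + t) x = Phi s (Phi t x);
  flow_continuous : continuous (fun z : R * M => Phi z.1 z.2);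
  flow_fixed : forall t x, C x -> Phi t x = x;
  flow_decr : forall t x, ~ C x -> 0 < t -> h (Phi t x) < h x;
  crit_isolated : forall u, C u -> \forall x \near u, C x -> x = u }.
Arguments lyap_continuous {R M h Phi C} _ _.
Arguments lyap_proper {R M h Phi C} _ _ _.
Arguments crit_isolated {R M h Phi C} _ _ _.
Arguments flow_continuous {R M h Phi C} _ _.

Lemma continuous_pair {T U V : topologicalType} (f : T -> U) (g : T -> V) :
  continuous f -> continuous g -> continuous (fun x => (f x, g x)).
Proof. by move=> cf cg x; apply: cvg_pair; [exact: cf|exact: cg]. Qed.

Lemma continuous_time {R : realType} {M : topologicalType} (Phi : R -> M -> M) x :
  continuous (fun z : R * M => Phi z.1 z.2) -> continuous (Phi ^~ x).
Proof.
move=> cPhi; have c : continuous (fun s : R => (s, x)).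
  by apply: continuous_pair => ?; [exact: cvg_id|exact: cvg_cst].
by move=> t; exact: (continuous_comp (c t) (cPhi (t, x))).
Qed.

Lemma continuous_space {R : realType} {M : topologicalType} (Phi : R -> M -> M) t :
  continuous (fun z : R * M => Phi z.1 z.2) -> continuous (Phi t).
Proof.
move=> cPhi; have c : continuous (fun y : M => (t, y)).
  by apply: continuous_pair => ?; [exact: cvg_cst|exact: cvg_id].
by move=> x; exact: (continuous_comp (c x) (cPhi (t, x))).
Qed.

(** Otherwise the times spent in [K] would form a subset of the connected segment that is both open
    and closed, as points of [K] on the path would all be interior. *)
Lemma path_hits_boundary {R : realType} {M : topologicalType} (f : R -> M)
    (K : set M) (t : R) : continuous f -> closed K -> 0 <= t ->
  K° (f 0) -> ~ K (f t) -> exists s, [/\ 0 <= s, s <= t, K (f s) & ~ K° (f s)].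
Proof.
move=> cf clK t0 K0 Kt; apply: contrapT => nex.
have KE s : `[0, t]%classic s -> K (f s) -> K° (f s).
  move=> /=; rewrite in_itv/= => /andP[s0 st] Ks; apply: contrapT => nKs.
  by apply: nex; exists s.
suff /seteqP[_ /(_ t)] : `[0, t]%classic `&` f @^-1` K = `[0, t]%classic.
  by rewrite /= in_itv/= lexx t0 => /(_ isT)[].
apply: (@segment_connected R 0 t).
- by exists 0 => /=; rewrite in_itv/= lexx t0; split => //; exact: interior_subset.
- exists (f @^-1` K°); first by apply: open_comp => //; exact: open_interior.
  apply/seteqP; split => s /= [si Ks]; split => //; first exact: KE.
  exact: interior_subset.
- by exists (f @^-1` K) => //; apply: closed_comp.
Qed.

Section lyapunov_flow.
Context {R : realType} {M : topologicalType}.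
Variables (h : M -> R) (Phi : R -> M -> M) (C : set M).
Hypothesis LF : lyapunov_flow h Phi C.

Lemma flowK t : cancel (Phi t) (Phi (- t)).
Proof. by move=> x; rewrite -(flowD LF) addNr (flow0 LF). Qed.

Lemma flow_continuous_time x : continuous (Phi ^~ x).
Proof. exact: continuous_time (flow_continuous LF). Qed.

Lemma flow_continuous_space t : continuous (Phi t).
Proof. exact: continuous_space (flow_continuous LF). Qed.

Lemma lyap_nincr t x : 0 <= t -> h (Phi t x) <= h x.
Proof.
rewrite le_eqVlt => /predU1P[<-|t0]; first by rewrite (flow0 LF).
have [Cx|Cx] := pselect (C x); first by rewrite (flow_fixed LF).
by apply/ltW/(flow_decr LF).
Qed.

Lemma lyap_nincr2 s t x : s <= t -> h (Phi t x) <= h (Phi s x).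
Proof.
by move=> st; rewrite -(subrK s t) (flowD LF) lyap_nincr// subr_ge0.
Qed.

Lemma crit_flow t x : C (Phi t x) -> C x.
Proof. by move=> Ct; rewrite -(flowK t x) (flow_fixed LF). Qed.

Lemma lyap_decr s t x : ~ C x -> s < t -> h (Phi t x) < h (Phi s x).
Proof.
move=> Cx st; rewrite -(subrK s t) (flowD LF) (flow_decr LF) ?subr_gt0//.
by move/crit_flow.
Qed.

Lemma lyap_le_time s t x : ~ C x -> h (Phi t x) <= h (Phi s x) -> s <= t.
Proof. by move=> Cx; apply: contraTT; rewrite -!ltNge; exact: lyap_decr. Qed.

Lemma lyap_inj_orbit s t x : h (Phi s x) = h (Phi t x) -> Phi s x = Phi t x.
Proof.
have [Cx|Cx] := pselect (C x); first by rewrite !(flow_fixed LF).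
move=> e; have [] := ltgtP s t; last by move->.
- by move=> /(lyap_decr Cx); rewrite e ltxx.
- by move=> /(lyap_decr Cx); rewrite e ltxx.
Qed.

(** Turns [C] into the zero set of a continuous function; this gives closedness and lets limit
    points be recognised as critical. *)
Lemma critE x : C x <-> h (Phi 1 x) = h x.
Proof.
split => [Cx|e]; first by rewrite (flow_fixed LF).
by apply: contrapT => /(flow_decr LF) /(_ ltr01); rewrite e ltxx.
Qed.

Lemma closed_crit : closed C.
Proof.
have -> : C = (fun x => h (Phi 1 x) - h x) @^-1` [set 0].
  apply/seteqP; split => x /=; first by move/critE => ->; rewrite subrr.
  by move/subr0_eq/critE.
apply: closed_comp; last exact: closed_eq.
move=> x _; apply: cvgB; last exact: (lyap_continuous LF).
apply: (@cvg_comp _ _ _ (Phi 1) h); first exact: flow_continuous_space.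
exact: (lyap_continuous LF).
Qed.

Lemma lyap_band_nbhs x : nbhs x [set y | h x - 1 <= h y <= h x + 1].
Proof.
have H : nbhs (h x) [set s | h x - 1 <= s <= h x + 1].
  by exists 1 => //= y; rewrite /ball_ /= ltr_norml => /andP[? ?]; apply/andP; split; lra.
exact: (lyap_continuous LF x _ H).
Qed.

(** Local compactness comes from properness: the slab of height 2 around [h x] is a compact
    neighbourhood, and compact Hausdorff spaces are regular. *)
Lemma regular_nbhs (x : M) (U : set M) : nbhs x U ->
  exists K, [/\ compact K, closed K, nbhs x K & K `<=` U].
Proof.
move=> xU; have := compact_regular (lyap_hausdorff LF)
  (lyap_proper LF (h x - 1) (h x + 1)) (lyap_band_nbhs x).
move=> /(_ _ (filterI xU (lyap_band_nbhs x)))[N xN NU].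
exists (closure N); split.
- apply: subclosed_compact (lyap_proper LF (h x - 1) (h x + 1)) _.
    exact: closed_closure.
  by move=> y /NU [].
- exact: closed_closure.
- by apply: filterS xN; exact: subset_closure.
- by move=> y /NU [].
Qed.

(** Tube lemma over the compact time interval [[0, t]]. *)
Lemma flow_near_segment (x : M) t (O : set M) : (forall s, 0 <= s <= t -> nbhs (Phi s x) O) ->
  \forall y \near x, forall s, 0 <= s <= t -> O (Phi s y).
Proof.
move=> xO; have /compact_near_coveringP cov := @segment_compact R 0 t.
have := cov M (nbhs x) (fun y s => O (Phi s y)) _; move=> /(_ _) H.
have {}H : \forall y \near x, `[0, t]%classic `<=` (fun s => O (Phi s y)).
  apply: H => s /= si.
  have := flow_continuous LF (s, x) O.
  rewrite /= /nbhs/= => H; apply: H; apply: xO.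
  by move: si; rewrite in_itv.
by apply: filterS H => y H s si; apply: H; rewrite /= in_itv.
Qed.

(* On the boundary of a small compact neighbourhood of [u] the value of [h]
   one unit of time earlier is larger by a definite amount. *)
Lemma crit_exit (u : M) (U : set M) : C u -> nbhs u U ->
  exists (V : set M) (e : R), [/\ nbhs u V, 0 < e &
    forall z t, V z -> 0 <= t -> ~ U (Phi t z) -> h (Phi t z) <= h u - e].
Proof.
move=> Cu uU.
have [K [cK clK uK KU]] := regular_nbhs (filterI uU (crit_isolated LF u Cu)).
pose D := K `&` ~` K°.
have cD : compact D.
  apply: subclosed_compact cK _; last by move=> ? [].
  by apply: closedI => //; rewrite closedC; exact: open_interior.
have DC z : D z -> ~ C z.
  move=> [Kz nKz] Cz; apply: nKz.
  by have [_ /(_ Cz) ->] := KU _ Kz.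
have cf : continuous (fun z => h (Phi (-1) z) - h z).
  move=> z; apply: cvgB; last exact: (lyap_continuous LF).
  apply: (@cvg_comp _ _ _ (Phi (-1)) h); first exact: flow_continuous_space.
  exact: (lyap_continuous LF).
have [e e0 De] : exists2 e, 0 < e & forall z, D z -> h z + e <= h (Phi (-1) z).
  have [->|D0] := eqVneq D set0; first by exists 1.
  have/set0P Dn0 := D0.
  have [|z /[!inE] Dz zmin] := compact_EVT_min Dn0 cD (f := fun z => h (Phi (-1) z) - h z).
    by apply: continuous_subspaceT.
  exists (h (Phi (-1) z) - h z).
    rewrite subr_gt0 -[X in h X < _](flow0 LF).
    by apply: lyap_decr; [exact: DC|rewrite ltrN10].
  by move=> y Dy; rewrite addrC -lerBrDr; apply: zmin; rewrite inE.
(* Staying one unit of time inside [K°] forces the exit time [s] to exceed 1, so the point one unit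
   before the exit is still on the forward orbit of [z] and lies below [h u + e / 2]. The drop [e]
   over that unit leaves [h u - e / 2]. *)
pose V := [set z | (forall s, 0 <= s <= 1 -> K° (Phi s z)) /\ h z < h u + e / 2].
exists V, (e / 2); split; last 2 first.
- by rewrite divr_gt0.
- move=> z t [Vz hz] t0 nU.
  have nK : ~ K (Phi t z) by move=> /KU[].
  have K0 : K° (Phi 0 z) by apply: Vz; rewrite lexx ler01.
  have [s [s0 st Ks nKs]] :=
    path_hits_boundary (@flow_continuous_time z) clK t0 K0 nK.
  have s1 : 1 < s.
    by rewrite ltNge; apply/negP => s1; apply: nKs; apply: Vz; rewrite s0.
  have := De _ (conj Ks nKs); rewrite -(flowD LF).
  have := lyap_nincr2 z st.
  have : h (Phi (-1 + s) z) <= h z.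
    by apply: lyap_nincr; rewrite addrC subr_ge0 ltW.
  by lra.
- apply: filterI.
    apply: flow_near_segment => s _; rewrite (flow_fixed LF)//.
    by apply: open_nbhs_nbhs; split; [exact: open_interior|].
  have H : nbhs (h u) [set s | s < h u + e / 2].
    by apply: lt_nbhsl; rewrite ltrDl divr_gt0.
  exact: (lyap_continuous LF u _ H).
Qed.

End lyapunov_flow.

(** * Stable and unstable sets, linkage, and time reversal *)

Definition stable {R : realType} {M : topologicalType} (Phi : R -> M -> M) (u : M) :
  set M := [set x | Phi t x @[t --> +oo] --> u].

Definition unstable {R : realType} {M : topologicalType} (Phi : R -> M -> M) (u : M) :
  set M := [set x | Phi t x @[t --> -oo] --> u].

(* [y] lies below [x] on a trajectory broken at most at one point [u]. *)
Definition linked {R : realType} {M : topologicalType} (Phi : R -> M -> M) (C : set M)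
    (x y : M) : Prop :=
  (exists t, 0 <= t /\ y = Phi t x) \/
  (exists u, [/\ C u, stable Phi u x & unstable Phi u y]).

Lemma hausdorff_separate {T : topologicalType} (x y : T) : hausdorff_space T -> x <> y ->
  exists A B, [/\ open_nbhs x A, open_nbhs y B & forall z, A z -> B z -> False].
Proof.
move=> hT xy; apply: contrapT => nex; apply: xy; apply: hT => A B.
rewrite !nbhsE => -[A' xA' A'A] [B' yB' B'B]; apply: contrapT => AB.
apply: nex; exists A', B'; split => // z Az Bz.
by apply: AB; exists z; split; [exact: A'A|exact: B'B].
Qed.

Section reversal.
Context {R : realType} {M : topologicalType}.
Variables (h : M -> R) (Phi : R -> M -> M) (C : set M).
Hypothesis LF : lyapunov_flow h Phi C.

(** The symmetry behind every later statement about unstable sets: it exchanges them with stable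
    sets, through [stable_rev]. *)
Lemma lyapunov_flow_rev : lyapunov_flow (fun x => - h x) (fun t => Phi (- t)) C.
Proof.
split.
- exact: lyap_hausdorff LF.
- by move=> x; apply: cvgN; exact: (lyap_continuous LF).
- move=> a b; have -> : [set x | a <= - h x <= b] = [set x | - b <= h x <= - a].
    by apply/seteqP; split => x /= /andP[? ?]; apply/andP; split; lra.
  exact: (lyap_proper LF (- b) (- a)).
- by move=> x; rewrite oppr0 (flow0 LF).
- by move=> s t x; rewrite opprD (flowD LF).
- have c : continuous (fun z : R * M => (- z.1, z.2)).
    apply: continuous_pair => z; last exact: cvg_snd.
    by apply: cvgN; exact: cvg_fst.
  by move=> z; exact: (continuous_comp (c z) (flow_continuous LF (- z.1, z.2))).
- by move=> t x; exact: (flow_fixed LF).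
- move=> t x Cx t0; rewrite ltrN2 -[X in h X < _](flow0 LF).
  by apply: (lyap_decr LF) => //; rewrite oppr_lt0.
- exact: (crit_isolated LF).
Qed.

Lemma stable_rev u : stable (fun t => Phi (- t)) u = unstable Phi u.
Proof.
by apply/seteqP; split => x H; apply/(cvgNy_compNP (Phi ^~ x) (nbhs u)).
Qed.

End reversal.

Section stable.
Context {R : realType} {M : topologicalType}.
Variables (h : M -> R) (Phi : R -> M -> M) (C : set M).
Hypothesis LF : lyapunov_flow h Phi C.

Lemma stable_ge u x t : stable Phi u x -> h u <= h (Phi t x).
Proof.
move=> xu; rewrite leNgt; apply/negP => lt.
have H : nbhs (h u) [set s | h (Phi t x) < s] by apply: lt_nbhsr.
have := xu _ (lyap_continuous LF u _ H) => /(filterI (nbhs_pinfty_ge (num_real t))).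
by move=> /filter_ex[s [/= ts]]; rewrite ltNge (lyap_nincr2 LF).
Qed.

Lemma stable_unique u u' x : stable Phi u x -> stable Phi u' x -> u = u'.
Proof. exact: (cvg_unique (lyap_hausdorff LF)). Qed.

Lemma stable_crit u : C u -> stable Phi u u.
Proof.
move=> Cu; rewrite /stable /=; under eq_fun do rewrite (flow_fixed LF)//.
exact: cvg_cst.
Qed.

Lemma stable_crit_eq u x : C x -> stable Phi u x -> x = u.
Proof. by move=> Cx; apply: stable_unique; exact: stable_crit. Qed.

Lemma stable_flow s u x : stable Phi u x -> stable Phi u (Phi s x).
Proof.
move=> xu U /xu[a [ar aU]]; exists (a - s); split; first exact: num_real.
by move=> t st /=; rewrite -(flowD LF); apply: aU; rewrite -ltrBlDr.
Qed.

Lemma stable_gt u x : stable Phi u x -> ~ C x -> h u < h x.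
Proof.
move=> xu Cx; apply: le_lt_trans (stable_ge 1 xu) _.
by apply: (flow_decr LF).
Qed.

(** Properness provides a cluster point [u], and [h] stays above [h u] along the orbit. If [u]
    moved, the orbit would drop below [h u] soon after passing near [u]. Convergence holds because
    leaving [U] after a visit to [V] would cost [e], again going below [h u]. *)
Lemma flow_cvg x a : (forall t, 0 <= t -> a <= h (Phi t x)) ->
  exists2 u, C u & stable Phi u x.
Proof.
move=> ax; pose F := Phi t x @[t --> +oo].
have FB : F [set y | a <= h y <= h x].
  by apply: filterS (nbhs_pinfty_ge (num_real 0)) => t t0 /=;
    rewrite ax// (lyap_nincr LF).
have [u [_ Fu]] := lyap_proper LF a (h x) F _ FB.
have ul t : h u <= h (Phi t x).
  rewrite leNgt; apply/negP => lt.
  have H : nbhs (h u) [set s | h (Phi t x) < s] by apply: lt_nbhsr.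
  have FA : F [set y | h y <= h (Phi t x)].
    by apply: filterS (nbhs_pinfty_ge (num_real t)) => s ts /=; exact: (lyap_nincr2 LF).
  have [y [/= y1]] := Fu _ _ FA (lyap_continuous LF u _ H).
  by rewrite ltNge y1.
have FT A : nbhs u A -> exists2 t, 0 <= t & A (Phi t x).
  move=> uA; have FA : F [set Phi t x | t in [set t | 0 <= t]].
    by apply: filterS (nbhs_pinfty_ge (num_real 0)) => s ts /=; exists s.
  by have [_ [[t t0 <-] At]] := Fu _ _ FA uA; exists t.
have Cu : C u.
  apply/(critE LF)/eqP; rewrite eq_le (lyap_nincr LF)//= leNgt; apply/negP => lt.
  have H : nbhs (h (Phi 1 u)) [set s | s < h u] by apply: lt_nbhsl.
  have [t _ /=] := FT _ (flow_continuous_space LF (lyap_continuous LF (Phi 1 u) _ H)).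
  by rewrite -(flowD LF) ltNge ul.
exists u => // U uU.
have [V [e [uV e0 Ve]]] := crit_exit LF Cu uU.
have [t t0 Vt] := FT _ uV.
apply: filterS (nbhs_pinfty_ge (num_real t)) => s ts /=; apply: contrapT => nU.
have := Ve _ (s - t) Vt; rewrite -(flowD LF) subrK subr_ge0 => /(_ ts nU).
by have := ul s; lra.
Qed.

End stable.

(** * Unstable sets and closedness of the linkage relation *)

Section unstable.
Context {R : realType} {M : topologicalType}.
Variables (h : M -> R) (Phi : R -> M -> M) (C : set M).
Hypothesis LF : lyapunov_flow h Phi C.
Let LFr := lyapunov_flow_rev LF.

Lemma unstable_le u x t : unstable Phi u x -> h (Phi t x) <= h u.
Proof.
by rewrite -stable_rev => /(stable_ge LFr (- t)); rewrite opprK lerN2.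
Qed.

Lemma unstable_unique u u' x : unstable Phi u x -> unstable Phi u' x -> u = u'.
Proof. by rewrite -!stable_rev; exact: (stable_unique LFr). Qed.

Lemma unstable_crit u : C u -> unstable Phi u u.
Proof. by rewrite -stable_rev; exact: (stable_crit LFr). Qed.

Lemma unstable_crit_eq u x : C x -> unstable Phi u x -> x = u.
Proof. by rewrite -stable_rev; exact: (stable_crit_eq LFr). Qed.

Lemma unstable_flow s u x : unstable Phi u x -> unstable Phi u (Phi s x).
Proof.
by rewrite -!stable_rev => /(stable_flow LFr (- s)); rewrite opprK.
Qed.

Lemma unstable_lt u x : unstable Phi u x -> ~ C x -> h x < h u.
Proof.
by rewrite -stable_rev => /(stable_gt LFr) /[apply]; rewrite ltrN2.
Qed.

Lemma flow_cvgNy x b : (forall t, 0 <= t -> h (Phi (- t) x) <= b) ->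
  exists2 u, C u & unstable Phi u x.
Proof.
move=> xb; have [t t0|u Cu] := @flow_cvg _ _ _ _ _ LFr x (- b).
  by rewrite lerN2 xb.
by rewrite stable_rev; exists u.
Qed.

Lemma linked_le x y : linked Phi C x y -> h y <= h x.
Proof.
move=> [[t [t0 ->]]|[u [Cu xu uy]]]; first exact: (lyap_nincr LF).
have := stable_ge LF 0 xu; have := unstable_le 0 uy.
by rewrite !(flow0 LF); exact: le_trans.
Qed.

(** For each [s] the points [y] and [Phi s x] have disjoint neighbourhoods; compactness of [[0, T]]
    makes the separation uniform in [s]. *)
Lemma closed_flow_segment T : closed [set z | exists t, 0 <= t <= T /\ z.2 = Phi t z.1].
Proof.
rewrite closedE => -[x y] /= nc; apply: contrapT => nxy; apply: nc.
have /compact_near_coveringP cov := @segment_compact R 0 T.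
have {}cov := cov (M * M)%type (nbhs (x, y)) (fun z s => z.2 <> Phi s z.1) _.
have H : \forall z \near (x, y), `[0, T]%classic `<=` (fun s => z.2 <> Phi s z.1).
  apply: cov => s si.
  have ys : y <> Phi s x by move=> ys; apply: nxy; exists s; split.
  have [A [B [Ay Bx AB]]] := hausdorff_separate (lyap_hausdorff LF) ys.
  have [[P Q] [/= sP xQ] PQ] : nbhs (s, x) ((fun z => Phi z.1 z.2) @^-1` B).
    have HB : nbhs (Phi s x) B by exact: open_nbhs_nbhs.
    exact: (flow_continuous LF (s, x) B HB).
  exists (P, (Q `*` A)) => /=.
    split => //; exists (Q, A) => //=; split => //; exact: open_nbhs_nbhs.
  move=> [t [x' y']] /= [Pt [Qx' Ay']] e.
  by apply: (AB y') => //; rewrite e; exact: (PQ (t, x')).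
by apply: filterS H => -[x' y'] /= H [t [tT e]]; apply: (H t).
Qed.

(** A break at [u] would give [h y <= h u <= h (Phi T x)], and a time beyond [T] would put [y] at or
    below [Phi T x]. *)
Lemma linked_segment x y T : 0 <= T -> linked Phi C x y -> h (Phi T x) < h y ->
  exists t, 0 <= t <= T /\ y = Phi t x.
Proof.
move=> T0 [[t [t0 ->]] lt|[u [Cu xu uy]] lt].
  exists t; split => //; rewrite t0 /= leNgt; apply/negP => tT.
  by move: lt; rewrite ltNge (lyap_nincr2 LF)// ltW.
move: lt; rewrite ltNge (le_trans _ (stable_ge LF T xu))//.
by have := unstable_le 0 uy; rewrite (flow0 LF).
Qed.

Lemma linked_segment_rev x y T : 0 <= T -> linked Phi C x y -> h x < h (Phi (- T) y) ->
  exists t, 0 <= t <= T /\ y = Phi t x.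
Proof.
move=> T0 [[t [t0 ->]] lt|[u [Cu xu uy]] lt].
  exists t; split => //; rewrite t0 /= leNgt; apply/negP => tT.
  move: lt; rewrite ltNge -(flowD LF) (lyap_nincr LF)//; lra.
move: lt; rewrite ltNge (le_trans (unstable_le _ uy))//.
by have := stable_ge LF 0 xu; rewrite (flow0 LF).
Qed.

(** If [x] falls strictly below [y] in finite time, or [y] rises strictly above [x] in finite
    backward time, the same holds nearby and bounds the travel times. Otherwise the forward limit
    [u] of [x] and the backward limit [u'] of [y] exist, and the hypothesis puts them on one level.
    If they differed, a linked pair close to [(x, y)] would pass near both, which the exit costs
    forbid. *)
Lemma closed_linked a b :
  (forall u u', C u -> C u' -> a <= h u <= b -> a <= h u' <= b -> h u = h u') ->
  closed [set z | [/\ linked Phi C z.1 z.2, a <= h z.2 & h z.1 <= b]].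
Proof.
move=> uniq_ab; set S := [set _ | _]; move=> [x y] /= clS.
have clh (f : M * M -> R) (D : set R) : continuous f -> closed D ->
    (forall z, S z -> D (f z)) -> D (f (x, y)).
  move=> cf clD SD; have : closed (f @^-1` D) by apply: closed_comp.
  by apply; apply: closure_subset clS.
have cfst : continuous (fun z : M * M => h z.1).
  by move=> z; exact: (continuous_comp (@cvg_fst _ _ _ _ _) (lyap_continuous LF z.1)).
have csnd : continuous (fun z : M * M => h z.2).
  by move=> z; exact: (continuous_comp (@cvg_snd _ _ _ _ _) (lyap_continuous LF z.2)).
have ay : a <= h y.
  by apply: (clh _ _ csnd (@closed_ge R a)) => z [].
have xb : h x <= b.
  by apply: (clh _ _ cfst (@closed_le R b)) => z [].
have yx : h y <= h x.
  rewrite -subr_ge0; apply: (clh (fun z => h z.1 - h z.2) _ _ (@closed_ge R 0)).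
    by move=> z; apply: cvgB; [exact: cfst|exact: csnd].
  by move=> z [/linked_le]; rewrite /= subr_ge0.
split => //.
(* If the limit can be reached only through bounded times, compactness of the
   time interval gives an unbroken limit. *)
have segment T : 0 <= T ->
    (\forall z \near (x, y), S z -> exists t, 0 <= t <= T /\ z.2 = Phi t z.1) ->
    linked Phi C x y.
  move=> T0 near_xy.
  have [|t [/andP[t0 _] yt]] := @closed_flow_segment T (x, y).
    by move=> B /(filterI near_xy)/clS[z [Sz [/(_ Sz) zT Bz]]]; exists z.
  by left; exists t.
have near_lt T T' : h (Phi T x) < h (Phi T' y) ->
    \forall z \near (x, y), h (Phi T z.1) < h (Phi T' z.2).
  move=> lt.
  have cf : continuous (fun z : M * M => h (Phi T' z.2) - h (Phi T z.1)).
    move=> z; apply: cvgB.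
      exact: (continuous_comp (continuous_comp (@cvg_snd _ _ _ _ _)
        (flow_continuous_space LF (t := T') (x := z.2))) (lyap_continuous LF _)).
    exact: (continuous_comp (continuous_comp (@cvg_fst _ _ _ _ _)
      (flow_continuous_space LF (t := T) (x := z.1))) (lyap_continuous LF _)).
  have H : nbhs (h (Phi T' y) - h (Phi T x)) [set s | 0 < s].
    by apply: lt_nbhsr; rewrite subr_gt0.
  have H2 : \forall z \near (x, y), 0 < h (Phi T' z.2) - h (Phi T z.1).
    exact: (cf (x, y) _ H).
  by apply: filterS H2 => z; rewrite subr_gt0.
have [[T [T0 lt]]|xT] := pselect (exists T, 0 <= T /\ h (Phi T x) < h y).
  apply: (segment T) => //; move: lt; rewrite -[X in _ < h X](flow0 LF).
  move=> /near_lt; apply: filterS => -[x' y'] /=; rewrite (flow0 LF) => lt [lk _ _].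
  exact: linked_segment.
have [[T [T0 lt]]|yT] := pselect (exists T, 0 <= T /\ h x < h (Phi (- T) y)).
  apply: (segment T) => //; move: lt; rewrite -[X in h X < _](flow0 LF).
  move=> /near_lt; apply: filterS => -[x' y'] /=; rewrite (flow0 LF) => lt [lk _ _].
  exact: linked_segment_rev.
have [|u Cu xu] := @flow_cvg _ _ _ _ _ LF x (h y).
  by move=> t t0; rewrite leNgt; apply/negP => lt; apply: xT; exists t.
have [|u' Cu' yu'] := @flow_cvgNy y (h x).
  by move=> t t0; rewrite leNgt; apply/negP => lt; apply: yT; exists t.
have [uu'|uu'] := pselect (u = u').
  by right; exists u; split => //; rewrite uu'.
exfalso.
have hxu t := stable_ge LF t xu.
have hyu t := unstable_le t yu'.
have yu : h y <= h u.
  rewrite leNgt; apply/negP => lt.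
  have H : nbhs (h u) [set s | s < h y] by apply: lt_nbhsl.
  have := xu _ (lyap_continuous LF u _ H) => /(filterI (nbhs_pinfty_ge (num_real 0))).
  by move=> /filter_ex[s [/= s0 lt']]; apply: xT; exists s.
have ux : h u' <= h x.
  rewrite leNgt; apply/negP => lt.
  have H : nbhs (h u') [set s | h x < s] by apply: lt_nbhsr.
  have := yu' _ (lyap_continuous LF u' _ H) => /(filterI (nbhs_ninfty_le (num_real 0))).
  move=> /filter_ex[s [/= s0 lt']]; apply: yT; exists (- s).
  by rewrite opprK oppr_ge0.
have hu : h u' = h u.
  apply: uniq_ab => //.
    by have := hyu 0; rewrite (flow0 LF) => ?; apply/andP; split; lra.
  by have := hxu 0; rewrite (flow0 LF) => ?; apply/andP; split; lra.
have hC u2 x' y' : C u2 -> stable Phi u2 x' -> unstable Phi u2 y' ->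
    a <= h y' -> h x' <= b -> h u2 = h u.
  move=> Cu2 /(stable_ge LF 0) + /(unstable_le 0); rewrite !(flow0 LF) => ? ? ? ?.
  apply: uniq_ab => //; first by apply/andP; split; lra.
  by have := hxu 0; rewrite (flow0 LF) => ?; apply/andP; split; lra.
have [A [B [uA u'B AB]]] := hausdorff_separate (lyap_hausdorff LF) uu'.
have [K [_ clK uK KA]] := regular_nbhs LF (open_nbhs_nbhs uA).
have [L [_ clL u'L LB]] := regular_nbhs LF (open_nbhs_nbhs u'B).
have KL z : K z -> L z -> False by move=> /KA ? /LB; exact: AB.
have [V [e [uV e0 Ve]]] := crit_exit LF Cu uK.
have [V' [e' [u'V' e'0 V'e']]] := crit_exit LF Cu' u'L.
have [V2 [e2 [u'V2 e20 V2e2]]] := crit_exit LFr Cu' u'L.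
(* The bounds are crossed on purpose: a point of [P] is too high to have left [L] after a visit to
   [V'], and a point of [Q] is too high to have left [K] after a visit to [V]. *)
pose P := [set z | [/\ V z, K z & h u - e' < h z]].
pose Q := [set z | [/\ V' z, V2 z, L z & h u - e < h z]].
have uP : nbhs u P.
  have H : nbhs (h u) [set s | h u - e' < s] by apply: lt_nbhsr; lra.
  by apply: filterS3 uV uK (lyap_continuous LF u _ H).
have u'Q : nbhs u' Q.
  have H : nbhs (h u') [set s | h u - e < s] by apply: lt_nbhsr; lra.
  apply: filterS3 (filterI u'V' u'V2) u'L (lyap_continuous LF u' _ H).
  by move=> z [].
have [T T0 xP] : exists2 T, 0 <= T & nbhs (Phi T x) P.
  have := xu _ (nbhs_interior uP).
  by move=> /(filterI (nbhs_pinfty_ge (num_real 0)))/filter_ex[T []]; exists T.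
have [T' T'0 yQ] : exists2 T', 0 <= T' & nbhs (Phi (- T') y) Q.
  have := yu' _ (nbhs_interior u'Q).
  move=> /(filterI (nbhs_ninfty_le (num_real 0)))/filter_ex[t [t0 yt]].
  by exists (- t); rewrite ?oppr_ge0// opprK.
have PQ : nbhs (x, y) [set z | P (Phi T z.1) /\ Q (Phi (- T') z.2)].
  exists (Phi T @^-1` P, Phi (- T') @^-1` Q) => //; split.
    exact: (flow_continuous_space LF (x := x) xP).
  exact: (flow_continuous_space LF (x := y) yQ).
have [[x' y'] [[/= lk ay' xb'] [[Vz Kz hz] [V'z V2z Lz hz']]]] := clS _ PQ.
have [[t [t0 y't]]|[u2 [Cu2 xu2 yu2]]] := lk.
  (* Both visits lie on one orbit; whichever comes second has left the neighbourhood of the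
     first. *)
  have [le0|lt0] := leP 0 (t - T' - T).
    have e1 : Phi (- T') y' = Phi (t - T' - T) (Phi T x').
      by rewrite y't -!(flowD LF); congr (Phi _ x'); ring.
    have := Ve _ _ Vz le0; rewrite -e1 => /(_ (fun k => KL _ k Lz)).
    by rewrite leNgt hz'.
  have e1 : Phi T x' = Phi (- (t - T' - T)) (Phi (- T') y').
    by rewrite y't -!(flowD LF); congr (Phi _ x'); ring.
  have := V'e' _ (- (t - T' - T)) V'z; rewrite -e1 oppr_ge0 => /(_ (ltW lt0)).
  by move=> /(_ (KL _ Kz)); rewrite leNgt hu hz.
have hu2 : h u2 = h u by exact: (hC _ _ _ Cu2 xu2 yu2).
(* The break [u2] lies at the level of [u] and [u']. The forward orbit towards [u2] cannot pay the
   cost of leaving [K], nor the backward orbit that of leaving [L], so [u2] lies in both closed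
   sets. *)
have Ku2 : K u2.
  have := stable_flow LF T xu2 => zu2.
  apply: (closed_cvg K clK _ u2 zu2).
  apply: filterS (nbhs_pinfty_ge (num_real 0)) => t t0; apply: contrapT => nK.
  have := Ve _ _ Vz t0 nK; have := stable_ge LF t (stable_flow LF T xu2); lra.
apply: (KL u2) => //.
have := unstable_flow (- T') yu2 => zu2.
apply: (closed_cvg L clL _ u2 zu2).
apply: filterS (nbhs_ninfty_le (num_real 0)) => t t0; apply: contrapT => nL.
have := V2e2 _ (- t) V2z; rewrite opprK oppr_ge0 => /(_ t0 nL).
by have := unstable_le t (unstable_flow (- T') yu2); lra.
Qed.

End unstable.

(** * Critical values and broken trajectories *)

(** On an infinite [A] the sets with finite complement in [A] form a proper filter. A cluster point
    [x] would be isolated in [A], yet [A] without [x] still belongs to the filter. *)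
Lemma compact_discrete_finite {T : topologicalType} (A : set T) : compact A ->
  (forall x, A x -> \forall y \near x, A y -> y = x) -> finite_set A.
Proof.
move=> cA dA; apply: contrapT => infA.
pose F : set_system T := [set B | finite_set (A `\` B)].
have FF : ProperFilter F.
  apply: Build_ProperFilter_ex.
    move=> B FB; apply: contrapT => nB; apply: infA.
    have <- : A `\` B = A.
      by apply/seteqP; split => [x []//|x Ax]; split => // Bx; apply: nB; exists x.
    exact: FB.
  split.
  - by rewrite /F /= setDT.
  - by move=> P Q FP FQ; rewrite /F /= setDIr finite_setU.
  - move=> P Q PQ; apply: sub_finite_set; exact: setDS.
have [|x [Ax Fx]] := cA F FF; first by rewrite /F /= setDv.
have FA : F (A `\ x).
  by rewrite /F /= setDD; apply: sub_finite_set (finite_set1 x) => y [].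
have [y [[Ay yx] /(_ Ay)]] := Fx _ _ FA (dA x Ax).
exact: yx.
Qed.

Lemma finite_set_max {R : realType} (A : set R) : finite_set A -> A !=set0 ->
  exists2 m, A m & forall x, A x -> x <= m.
Proof.
move=> /finite_compact cA A0; have [|m] := compact_EVT_max A0 cA (f := id).
  by apply: continuous_subspaceT => x; exact: cvg_id.
by rewrite inE => Am mA; exists m => // x Ax; apply: mA; rewrite inE.
Qed.

Lemma finite_set_min {R : realType} (A : set R) : finite_set A -> A !=set0 ->
  exists2 m, A m & forall x, A x -> m <= x.
Proof.
move=> /finite_compact cA A0; have [|m] := compact_EVT_min A0 cA (f := id).
  by apply: continuous_subspaceT => x; exact: cvg_id.
by rewrite inE => Am mA; exists m => // x Ax; apply: mA; rewrite inE.
Qed.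

Section levels.
Context {R : realType} {M : topologicalType}.
Variables (h : M -> R) (Phi : R -> M -> M) (C : set M).
Hypothesis LF : lyapunov_flow h Phi C.

Lemma finite_crit a b : finite_set (C `&` [set x | a <= h x <= b]).
Proof.
apply: compact_discrete_finite.
  apply: subclosed_compact (lyap_proper LF a b) _; last by move=> ? [].
  apply: closedI; first exact: closed_crit LF.
  exact: compact_closed (lyap_hausdorff LF) (lyap_proper LF a b).
move=> x [Cx _]; apply: filterS (crit_isolated LF x Cx) => y H [Cy _].
exact: H.
Qed.

Lemma finite_crit_value a b : finite_set [set c | (h @` C) c /\ a <= c <= b].
Proof.
apply: sub_finite_set (finite_image h (finite_crit a b)).
by move=> c [[x Cx <-] xab]; exists x.
Qed.

Lemma orbit_level x a b s : a <= b -> h (Phi b x) <= s <= h (Phi a x) ->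
  exists2 t, a <= t <= b & h (Phi t x) = s.
Proof.
move=> ab /andP[bs sa].
have ct : {within `[a, b], continuous (fun t => h (Phi t x))}.
  apply: continuous_subspaceT => t.
  exact: (continuous_comp (@flow_continuous_time _ _ _ _ _ LF x t) (lyap_continuous LF _)).
have [|t] := IVT ab ct (v := s); first by rewrite ge_min le_max sa bs orbT.
by rewrite in_itv /=; exists t.
Qed.

Lemma stable_level u x s : stable Phi u x -> h u < s <= h x ->
  exists2 t, 0 <= t & h (Phi t x) = s.
Proof.
move=> xu /andP[us sx].
have H : nbhs (h u) [set s' | s' < s] by apply: lt_nbhsl.
have := xu _ (lyap_continuous LF u _ H) => /(filterI (nbhs_pinfty_ge (num_real 0))).
move=> /filter_ex[T [/= T0 lt]].
have [|t /andP[t0 _] ts] := @orbit_level x 0 T s T0.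
  by rewrite (flow0 LF) sx ltW.
by exists t.
Qed.

(** An orbit staying above [s] converges to a critical point below [h x]; the hypothesis places its
    value below [s], so the level is crossed after all. *)
Lemma orbit_down x s : ~ C x -> s <= h x -> (forall u, C u -> ~~ (s <= h u < h x)) ->
  exists2 t, 0 <= t & h (Phi t x) = s.
Proof.
move=> Cx sx noC.
have [[T [T0 lt]]|nT] := pselect (exists T, 0 <= T /\ h (Phi T x) <= s).
  have [|t /andP[t0 _] ts] := @orbit_level x 0 T s T0; last by exists t.
  by rewrite (flow0 LF) sx lt.
have [|u Cu xu] := @flow_cvg _ _ _ _ _ LF x s.
  by move=> t t0; rewrite leNgt; apply/negP => lt; apply: nT; exists t; split => //; exact: ltW.
have us : h u <= s.
  rewrite leNgt; apply/negP => us; move: (noC u Cu).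
  by rewrite (ltW us) (stable_gt LF xu Cx).
have us' : h u < s.
  rewrite lt_neqAle us andbT; apply/eqP => e; move: (noC u Cu).
  by rewrite e lexx -e (stable_gt LF xu Cx).
by apply: (stable_level xu); rewrite us'.
Qed.

End levels.

Section levels_up.
Context {R : realType} {M : topologicalType}.
Variables (h : M -> R) (Phi : R -> M -> M) (C : set M).
Hypothesis LF : lyapunov_flow h Phi C.
Let LFr := lyapunov_flow_rev LF.

Lemma unstable_level u x s : unstable Phi u x -> h x <= s < h u ->
  exists2 t, t <= 0 & h (Phi t x) = s.
Proof.
rewrite -stable_rev => xu /andP[xs su].
have [|t t0 /oppr_inj ts] := @stable_level _ _ _ _ _ LFr u x (- s) xu.
  by rewrite ltrN2 su lerN2.
by exists (- t); rewrite ?oppr_le0.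
Qed.

End levels_up.

Section critical_values.
Context {R : realType} {n : nat} {M : manifold R n}.
Variables (h : M -> R) (Phi : R -> M -> M).
Hypothesis LF : lyapunov_flow h Phi (Crit h).

(** By properness finitely many critical values lie between [c'] and [c]; [c'] ensures that there is
    one below [c] at all. *)
Lemma next_below_ex c' c : crit_value h c' -> crit_value h c -> c' < c ->
  exists2 d, next_below h d c & c' <= d.
Proof.
move=> Vc' Vc lt.
have fin := finite_crit_value LF c' c.
have [||d [[Vd /andP[c'd _]] dc] dmax] := @finite_set_max R
    [set e | (crit_value h e /\ c' <= e <= c) /\ e < c].
- by apply: sub_finite_set fin => e [].
- by exists c'; rewrite /= lexx ltW.
exists d => //; split => // e Ve; apply/negP => /andP[de ec].
have := de; rewrite ltNge dmax//=; split => //; split => //; apply/andP; split; lra.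
Qed.

Lemma next_above_ex c c' : crit_value h c -> crit_value h c' -> c < c' ->
  exists2 d, next_below h c d & d <= c'.
Proof.
move=> Vc Vc' lt.
have fin := finite_crit_value LF c c'.
have [||d [[Vd /andP[_ dc']] cd] dmin] := @finite_set_min R
    [set e | (crit_value h e /\ c <= e <= c') /\ c < e].
- by apply: sub_finite_set fin => e [].
- by exists c'; rewrite /= lexx ltW.
exists d => //; split => // e Ve; apply/negP => /andP[ce ed].
have := ed; rewrite ltNge dmin//=; split => //; split => //; apply/andP; split; lra.
Qed.

(** Descending induction along consecutive critical values, in place of an induction on their
    indices. The highest level violating [P] would have a critical value just above it where [P]
    holds. *)
Lemma crit_levels_ind lo hi (P : R -> Prop) : crit_value h hi -> P hi ->
  (forall d d1, next_below h d1 d -> lo < d1 -> d <= hi -> P d -> P d1) ->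
  forall d, crit_levels h lo hi d -> P d.
Proof.
move=> Vhi Phi0 step d [Vd /andP[lod dhi]]; apply: contrapT => nPd.
have fin := finite_crit_value LF d hi.
have [||m [[Vm /andP[dm mhi]] nPm] mmax] := @finite_set_max R
    [set e | (crit_value h e /\ d <= e <= hi) /\ ~ P e].
- by apply: sub_finite_set fin => e [].
- by exists d; rewrite /= lexx dhi.
have mlt : m < hi.
  by rewrite lt_neqAle mhi andbT; apply/eqP => e; apply: nPm; rewrite e.
have [e em ehi] := next_above_ex Vm Vhi mlt.
apply: nPm; apply: (step e) => //; first lra.
apply: contrapT => nPe; have [_ Ve me _] := em.
have := me; rewrite ltNge mmax//=; split => //; split => //; apply/andP; split; lra.
Qed.

End critical_values.

(** * Broken trajectories as subsets of the manifold *)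

Section strand.
Context {R : realType} {n : nat} {M : manifold R n}.
Variables (h : M -> R) (Phi : R -> M -> M).
Hypothesis LF : lyapunov_flow h Phi (Crit h).

(* For [g] in B(v, u) and [x] in W^-_u: the broken trajectory [g], continued by
   the whole orbit of [x]. *)
Definition strand (v : M) (g : seq (set M * M)) (x : M) : set M :=
  path_trace v g `|` flow_orbit Phi x.

Lemma flow_orbit_refl x : flow_orbit Phi x x.
Proof. by exists 0 => //; rewrite (flow0 LF). Qed.

Lemma flow_orbit_eq x y : flow_orbit Phi x y -> flow_orbit Phi y = flow_orbit Phi x.
Proof.
move=> [t _ <-]; apply/seteqP; split => z [s _ <-].
  by exists (s + t) => //; rewrite (flowD LF).
by exists (s - t) => //; rewrite -(flowD LF) subrK.
Qed.

Lemma TrajP v u o y : Traj Phi v u o -> o y ->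
  [/\ o = flow_orbit Phi y, unstable Phi v y & stable Phi u y].
Proof.
move=> [z [vz zu] ->] zy; rewrite (flow_orbit_eq zy); split => //.
  by case: zy => t _ <-; exact: (unstable_flow LF t vz).
by case: zy => t _ <-; exact: (stable_flow LF t zu).
Qed.

Lemma Traj_not_crit v u o y : Traj Phi v u o -> h u < h v -> o y -> ~ Crit h y.
Proof.
move=> vuo uv oy Cy; have [_ vy yu] := TrajP vuo oy; move: uv.
by rewrite -(unstable_crit_eq LF Cy vy) (stable_crit_eq LF Cy yu) ltxx.
Qed.

Lemma Traj_lt v u o y : Traj Phi v u o -> h u < h v -> o y -> h u < h y < h v.
Proof.
move=> vuo uv oy; have Cy := Traj_not_crit vuo uv oy.
have [_ vy yu] := TrajP vuo oy.
by rewrite (stable_gt LF yu Cy) (unstable_lt LF vy Cy).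
Qed.

Lemma strand_le v u g x y : broken h Phi v u g -> unstable Phi u x ->
  strand v g x y -> h y <= h v /\ (h y = h v -> y = v).
Proof.
elim: g v => [|[ o u1] g IH] v /=.
  move=> <- vx [->|[t _ <-]]; first by [].
  have vt := unstable_flow LF t vx.
  have := unstable_le LF t vx; split => // e; apply/esym.
  have [Ct|Ct] := pselect (Crit h (Phi t x)).
    by rewrite (unstable_crit_eq LF Ct vt).
  by have := unstable_lt LF vt Ct; rewrite e ltxx.
move=> [Cu1 [_ u1v] vo bg] ux [[ [->|oy]|gy]|xy]; first by [].
- have /andP[_ yv] := Traj_lt vo u1v oy.
  by split; [exact: ltW|move=> e; move: yv; rewrite e ltxx].
- have [yu1 _] := IH _ bg ux (or_introl gy).
  by split; [lra|move=> e; exfalso; lra].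
- have [yu1 _] := IH _ bg ux (or_intror xy).
  by split; [lra|move=> e; exfalso; lra].
Qed.

Lemma strand_cons v o u1 g x y : strand v ((o, u1) :: g) x y ->
  [\/ y = v, o y | strand u1 g x y].
Proof.
move=> [[ [->|oy]|gy]|xy].
- exact: Or31.
- exact: Or32.
- by apply: Or33; left.
- by apply: Or33; right.
Qed.

(** The vertices and trajectories of a strand occupy disjoint ranges of levels, and [h] is injective
    on each orbit. This is what makes the choices in [path_at] and [hat_path_at] unambiguous. *)
Lemma strand_inj v u g x y z : broken h Phi v u g -> unstable Phi u x ->
  strand v g x y -> strand v g x z -> h y = h z -> y = z.
Proof.
elim: g v y z => [|[ o u1] g IH] v y z bg ux Ty Tz e.
  have [_ yv] := strand_le bg ux Ty.
  have [_ zv] := strand_le bg ux Tz.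
  move: bg ux => /= <- vx.
  case: Ty => [y_v|[t _ ty]]; first by rewrite zv ?y_v// -e y_v.
  case: Tz => [z_v|[t' _ tz]]; first by rewrite yv ?z_v// e z_v.
  by move: e; rewrite -ty -tz; exact: (lyap_inj_orbit LF).
have [_ yv] := strand_le bg ux Ty.
have [_ zv] := strand_le bg ux Tz.
have [Cu1 [_ u1v] vo bg1] := bg.
have le1 y' : strand u1 g x y' -> h y' <= h u1 by move=> /(strand_le bg1 ux)[].
have lto y' : o y' -> h u1 < h y' < h v by exact: (Traj_lt vo).
case: (strand_cons Ty) => [y_v|oy|gy]; case: (strand_cons Tz) => [z_v|oz|gz].
- by rewrite y_v z_v.
- by rewrite zv -?e y_v.
- by rewrite zv -?e y_v.
- by rewrite yv// e z_v.
- have [ oE _ _] := TrajP vo oy; move: oz e; rewrite oE => -[t _ <-].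
  by rewrite -[in LHS](flow0 LF y) => /(lyap_inj_orbit LF); rewrite (flow0 LF).
- by have := le1 _ gz; have /andP[] := lto _ oy => *; exfalso; lra.
- by rewrite yv// e z_v.
- by have := le1 _ gy; have /andP[] := lto _ oz => *; exfalso; lra.
- exact: IH bg1 ux gy gz e.
Qed.

Lemma orbit_linked x y z : flow_orbit Phi x y -> flow_orbit Phi x z -> h z <= h y ->
  linked Phi (Crit h) y z.
Proof.
move=> xy; rewrite -(flow_orbit_eq xy) => -[t _ <-] le; left.
have [Cy|Cy] := pselect (Crit h y).
  by exists 0; rewrite !(flow_fixed LF).
by exists t; split => //; apply: (lyap_le_time LF Cy); rewrite (flow0 LF).
Qed.

(** Consecutive vertices have distinct critical values, so a strand cannot break twice over an
    interval containing only one. *)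
Lemma strand_linked v u g x y z : Crit h v -> broken h Phi v u g -> unstable Phi u x ->
  strand v g x y -> strand v g x z -> h z <= h y ->
  (forall c c', crit_value h c -> crit_value h c' ->
     h z <= c <= h y -> h z <= c' <= h y -> c = c') ->
  linked Phi (Crit h) y z.
Proof.
elim: g v y z => [|[ o u1] g IH] v y z Cv bg ux Ty Tz zy uniq_zy.
  have [_ zv] := strand_le bg ux Tz.
  have [hz _] := strand_le bg ux Tz.
  have [_ yv] := strand_le bg ux Ty.
  have [hy _] := strand_le bg ux Ty.
  move: bg ux => /= uv; rewrite -{}uv => vx.
  have vC z' : unstable Phi v z' -> linked Phi (Crit h) v z'.
    by move=> vz'; right; exists v; split => //; exact: (stable_crit LF Cv).
  case: Ty => [y_v|xy]; case: Tz => [z_v|xz].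
  - by rewrite y_v z_v; apply: vC; exact: (unstable_crit LF Cv).
  - by rewrite y_v; apply: vC; case: xz => t _ <-; exact: (unstable_flow LF).
  - have -> : y = z by rewrite z_v; apply: yv; apply/eqP; rewrite eq_le hy -z_v.
    by left; exists 0; rewrite (flow0 LF).
  - exact: (orbit_linked xy xz zy).
have [_ zv] := strand_le bg ux Tz.
have [_ yv] := strand_le bg ux Ty.
have [hy _] := strand_le bg ux Ty.
have [Cu1 [_ u1v] vo bg1] := bg.
have le1 y' : strand u1 g x y' -> h y' <= h u1 by move=> /(strand_le bg1 ux)[].
have lto y' : o y' -> h u1 < h y' < h v by exact: (Traj_lt vo).
have Vv : crit_value h (h v) by exists v.
have Vu1 : crit_value h (h u1) by exists u1.
case: (strand_cons Ty) => [y_v|oy|gy]; case: (strand_cons Tz) => [z_v|oz|gz].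
- by rewrite y_v z_v; left; exists 0; rewrite (flow0 LF).
- rewrite y_v; right; exists v; split => //; first exact: (stable_crit LF Cv).
  by have [] := TrajP vo oz.
- have := le1 _ gz => zu1; have := uniq_zy _ _ Vv Vu1.
  rewrite y_v lexx zu1 (ltW u1v) -{1}y_v zy => /(_ isT isT) e.
  by move: u1v; rewrite e ltxx.
- by have /andP[_ yv2] := lto _ oy; move: zy; rewrite z_v leNgt yv2.
- have [ oE _ _] := TrajP vo oy; rewrite oE in oz.
  exact: (orbit_linked (flow_orbit_refl y) oz zy).
- have zu1 := le1 _ gz; have /andP[u1y yv'] := lto _ oy.
  have [_ _ yu1] := TrajP vo oy.
  right; exists u1; split => //.
  (* The strand breaks at [u1] before reaching [z]. It remains to see that [z] comes out of [u1]
     directly: past a second vertex [u2], both [h u1] and [h u2] would lie between [h z] and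
     [h y]. *)
  case: g => [|[ o' u2] g] in bg bg1 gz Ty Tz IH le1 *.
    move: bg1 ux => /= <- ux'; case: gz => [->|[t _ <-]].
      exact: (unstable_crit LF Cu1).
    exact: (unstable_flow LF).
  have [Cu2 [_ u21] uo' bg2] := bg1.
  case: (strand_cons gz) => [->|o'z|g'z].
  + exact: (unstable_crit LF Cu1).
  + by have [] := TrajP uo' o'z.
  + have [zu2 _] := strand_le bg2 ux g'z.
    have Vu2 : crit_value h (h u2) by exists u2.
    have := uniq_zy _ _ Vu1 Vu2; rewrite zu1 zu2 (ltW u1y) => /(_ isT).
    have -> : h u2 <= h y by lra.
    by move=> /(_ isT) e; move: u21; rewrite e ltxx.
- by move: zy; rewrite z_v leNgt (le_lt_trans (le1 _ gy) u1v).
- by have /andP[u1z _] := lto _ oz; move: zy; rewrite leNgt (le_lt_trans (le1 _ gy) u1z).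
- exact: (IH _ _ _ Cu1 bg1 ux gy gz zy uniq_zy).
Qed.

Lemma strand_level v u g x s : broken h Phi v u g -> unstable Phi u x ->
  h x <= s <= h v -> exists2 y, strand v g x y & h y = s.
Proof.
elim: g v => [|[ o u1] g IH] v.
  move=> /= <- vx /andP[xs]; rewrite le_eqVlt => /predU1P[->|sv].
    by exists v => //; left.
  have [|t _ ts] := unstable_level LF vx (s := s); first by rewrite xs.
  by exists (Phi t x) => //; right; exists t.
move=> [Cu1 [_ u1v] vo bg1] ux /andP[xs sv].
have [su1|u1s] := leP s (h u1).
  have [|y [gy|xy] ys] := IH _ bg1 ux; first by rewrite xs su1.
    by exists y => //; left; right.
  by exists y => //; right.
move: sv; rewrite le_eqVlt => /predU1P[->|sv].
  by exists v => //; left; left; left.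
have [z [vz zu1] oE] := vo.
have [sz|zs] := leP s (h z).
  have [|t _ ts] := stable_level LF zu1 (s := s); first by rewrite u1s.
  by exists (Phi t z) => //; left; left; right; rewrite oE; exists t.
have [|t _ ts] := unstable_level LF vz (s := s); first by rewrite sv ltW.
by exists (Phi t z) => //; left; left; right; rewrite oE; exists t.
Qed.

Lemma path_trace_head (v : M) g : path_trace v g v.
Proof. by case: g => [|[ o u] g] //; left; left. Qed.

Lemma path_trace_last v u g : broken h Phi v u g -> path_trace v g u.
Proof. by elim: g v => [|[ o u1] g IH] v /= => [->//|[_ _ _ /IH]]; right. Qed.

Lemma broken_crit_le v u g : broken h Phi v u g -> crit_le h u v.
Proof.
elim: g v => [|[ o u1] g IH] v /= => [->|[_ [iu1 hu1] _ /IH]]; first by right.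
by case=> [[iu hu]|->]; left; split;
  [exact: ltn_trans iu iu1|exact: lt_trans hu hu1|exact: iu1|exact: hu1].
Qed.

Lemma broken_le v u g : broken h Phi v u g -> h u <= h v.
Proof. by move=> /broken_crit_le[[_ /ltW]|->]. Qed.

Lemma path_trace_ge v u g y : broken h Phi v u g -> path_trace v g y -> h u <= h y.
Proof.
elim: g v => [|[ o u1] g IH] v /=; first by move=> <- ->.
move=> [Cu1 [_ u1v] vo bg1] [ [->|oy]|gy]; last exact: IH bg1 gy.
  exact: le_trans (broken_le bg1) (ltW u1v).
have /andP[u1y _] := Traj_lt vo u1v oy.
exact: le_trans (broken_le bg1) (ltW u1y).
Qed.

Lemma broken_rcons v u g o u' : broken h Phi v u g -> Crit h u' -> crit_lt h u' u ->
  Traj Phi u u' o -> broken h Phi v u' (rcons g (o, u')).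
Proof.
elim: g v => [|[ o1 u1] g IH] v /=; first by move=> <-.
by move=> [? ? ? bg] Cu' u'u uo; split => //; exact: IH.
Qed.

Lemma path_trace_rcons (v : M) g o u : path_trace v (rcons g (o, u)) =
  path_trace v g `|` (o `|` [set u]).
Proof.
elim: g v => [|[ o1 u1] g IH] v /=; first by rewrite setUA.
by rewrite IH setUA.
Qed.

Lemma path_atE v u g y : broken h Phi v u g -> Crit h u -> path_trace v g y ->
  path_at h v g (h y) = y.
Proof.
move=> bg Cu gy; rewrite /path_at; case: xgetP => [z -> [gz /= e]|/(_ y)[]//].
apply: (strand_inj bg (unstable_crit LF Cu)) e; by left.
Qed.


Lemma hw_pathP (v : M) (p : hatW h Phi v) :
  broken h Phi v (hw_end p) (set_val (hw_path p)).
Proof. exact: set_mem (valP (hw_path p)). Qed.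

Lemma hw_ptP (v : M) (p : hatW h Phi v) : unstable Phi (hw_end p) (hat_i p).
Proof. exact: set_mem (valP (hw_pt p)). Qed.

(* The orbit of [x] may be searched for in both directions, although the
   definition of [hat_path_at] only looks on one side of [x]. *)
Lemma hat_path_atE (v : M) (p : hatW h Phi v) y :
  strand v (set_val (hw_path p)) (hat_i p) y -> hat_path_at p (h y) = y.
Proof.
move=> Ty; have bg := hw_pathP p; have ux := @hw_ptP v p; rewrite /hat_path_at.
set x := hat_i p in Ty ux *; set g := set_val (hw_path p) in Ty bg *.
have [xy|yx] := leP (h x) (h y).
  case: xgetP => [z -> [Tz /= e]|/(_ y)[]].
    apply: (strand_inj bg ux) e => //.
    by case: Tz => [gz|[t _ <-]]; [left|right; exists t].
  split => //; case: Ty => [gy|[t _ ty]]; [by left|right].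
  have [Cx|Cx] := pselect (Crit h x).
    by exists 0; rewrite -?ty ?(flow_fixed LF)//= lexx.
  exists t => //=; apply: (lyap_le_time LF Cx).
  by rewrite (flow0 LF) ty.
have xu : h x <= h (hw_end p) by have := unstable_le LF 0 ux; rewrite (flow0 LF).
have [t ty t0] : exists2 t, Phi t x = y & 0 <= t.
  case: Ty => [/(path_trace_ge bg)|[t _ ty]].
    by move=> /(le_trans xu); rewrite leNgt yx.
  exists t => //; have [Cx|Cx] := pselect (Crit h x).
    by move: yx; rewrite -ty (flow_fixed LF)// ltxx.
  by apply: (lyap_le_time LF Cx); rewrite (flow0 LF) ty ltW.
case: xgetP => [z -> [[s _ sz] /= e]|/(_ y)[]].
  apply: (strand_inj bg ux) e; first by right; exists s.
  by right; exists t.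
by split => //; exists t.
Qed.

End strand.

(** * The image of the level maps *)

Section chains.
Context {R : realType} {n : nat} {M : manifold R n}.
Variables (h : M -> R) (Phi : R -> M -> M).
Hypothesis LF : lyapunov_flow h Phi (Crit h).
Hypothesis index_drop : forall v w x, Crit h v -> Crit h w -> v <> w ->
  unstable Phi v x -> stable Phi w x -> (morse_index h w < morse_index h v)%N.
Variables (v : M) (c eps : R).
Hypotheses (Cv : Crit h v) (Vc : crit_value h c) (cv : c <= h v).
Hypothesis epsP : eps_small h c (h v) eps.

Local Notation levels := (set_type (crit_levels h c (h v))).
Local Notation sections := (prod_topology (fun _ : levels => (M : topologicalType))).

Lemma levelP (i : levels) : [/\ crit_value h (set_val i), c < set_val i & set_val i <= h v].
Proof. by case: (set_mem (valP i)) => Vi /andP[]. Qed.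

(** No critical value lies within [2 * eps] below a critical level. Hence the sections at
    [set_val i - eps] are noncritical, and the interval between two consecutive sections contains a
    single critical value. *)
Lemma level_gap (i : levels) e : crit_value h e -> set_val i - 2 * eps <= e -> set_val i <= e.
Proof.
move=> Ve ei; rewrite leNgt; apply/negP => lt.
have [Vi ci iv] := levelP i.
have [d nbd ed] := next_below_ex LF Ve Vi lt.
by case: epsP => _ /(_ (set_val i) d (set_mem (valP i)) nbd) lt'; lra.
Qed.

Lemma eps_gt0 : 0 < eps. Proof. by case: epsP. Qed.

Lemma level_lt (i : levels) : c < set_val i - 2 * eps.
Proof.
have [_ ci _] := levelP i; rewrite ltNge; apply/negP => /(level_gap Vc).
by rewrite leNgt ci.
Qed.

Lemma level_not_crit (i : levels) x : h x = set_val i - eps -> ~ Crit h x.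
Proof.
move=> hx Cx; have Vx : crit_value h (h x) by exists x.
by have := level_gap (i := i) Vx; have := eps_gt0; rewrite hx => ? H; have := H _; lra.
Qed.

Definition linked_in a b : set (M * M) :=
  [set z | [/\ linked Phi (Crit h) z.1 z.2, a <= h z.2 & h z.1 <= b]].

(* The image of [hatJ] over [a <= h <= b]; unlike the definition of that image,
   these conditions are visibly closed. *)
Definition chains a b : set (sections * M) := [set z | [/\
  forall i, h (z.1 i) = set_val i - eps,
  forall i, set_val i = h v -> linked_in (h v - eps) (h v) (v, z.1 i),
  forall i j, next_below h (set_val j) (set_val i) ->
    linked_in (set_val j - eps) (set_val i - eps) (z.1 i, z.1 j),
  forall i, next_below h c (set_val i) ->
    linked_in a (set_val i - eps) (z.1 i, z.2) \/
    linked_in (set_val i - eps) b (z.2, z.1 i) &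
  [/\ a <= h z.2, h z.2 <= b & c = h v -> linked_in a (h v) (v, z.2)]]].

(* [hatJ], without the restriction to a band. *)
Definition section (p : hatW h Phi v) : sections * M :=
  (fun d => hat_path_at p (set_val d - eps), hat_i p).

Lemma linked_from_crit u x : Crit h u -> linked Phi (Crit h) u x -> unstable Phi u x.
Proof.
move=> Cu [[t [_ ->]]|[u' [Cu' uu' u'x]]].
  by rewrite (flow_fixed LF)//; exact: (unstable_crit LF).
by rewrite (stable_crit_eq LF Cu uu').
Qed.

Lemma linked_orbit x y : linked Phi (Crit h) x y -> (exists t, y = Phi t x) \/
  (exists u, [/\ Crit h u, stable Phi u x & unstable Phi u y]).
Proof. by move=> [[t [_ ->]]|H]; [left; exists t|right]. Qed.

(** Either the same orbit continues, or its limit [u'] is appended as a new vertex. The decrease of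
    [h] required by [crit_lt] comes from the flow, that of the index from [index_drop]. The time [t]
    may be negative, because an end point may lie above the lowest section. *)
Lemma strand_extend u g x y : Crit h u -> broken h Phi v u g -> unstable Phi u x -> ~ Crit h x ->
  (exists t, y = Phi t x) \/ (exists u', [/\ Crit h u', stable Phi u' x & unstable Phi u' y]) ->
  exists u' g', [/\ Crit h u', broken h Phi v u' g', unstable Phi u' y &
    strand Phi v g x `<=` strand Phi v g' y].
Proof.
move=> Cu bg ux Cx [[t ->]|[u' [Cu' xu' u'y]]].
  exists u, g; split => //; first exact: (unstable_flow LF).
  have e : flow_orbit Phi (Phi t x) = flow_orbit Phi x.
    by apply: (flow_orbit_eq LF); exists t.
  by rewrite /strand e.
have uu' : u <> u'.
  move=> e; have := stable_gt LF xu' Cx; have := unstable_lt LF ux Cx.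
  by rewrite e => /lt_trans /[apply]; rewrite ltxx.
have lt : crit_lt h u' u.
  split; first exact: (index_drop Cu Cu' uu' ux xu').
  exact: lt_trans (stable_gt LF xu' Cx) (unstable_lt LF ux Cx).
have tr : Traj Phi u u' (flow_orbit Phi x) by exists x.
exists u', (rcons g (flow_orbit Phi x, u')).
split; [exact: Cu'|exact: broken_rcons bg Cu' lt tr|exact: u'y|].
rewrite /strand path_trace_rcons => z [gz|xz]; left; first by left.
by right; left.
Qed.

(** Converse of [section_chains]: the links are glued from the top section downwards. The bound on
    [b] keeps the end point below the next critical level, so that a link from the end point down to
    the lowest section cannot break. *)
Lemma chains_section (a b : R) (z : sections * M) : chains a b z ->
  (forall d, next_below h c d -> b < d) -> exists p : hatW h Phi v, section p = z.
Proof.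
move=> [lev top step bot [_ zb single]] bnd.
suff [u [g [Cu bg ux gz]]] : exists u g, [/\ Crit h u, broken h Phi v u g,
    unstable Phi u z.2 & forall j, strand Phi v g z.2 (z.1 j)].
  pose p := HatW Cu (broken_crit_le bg) (SigSub (mem_set bg)) (SigSub (mem_set ux)).
  exists p; rewrite /section [RHS]surjective_pairing; congr pair.
  apply/funext => i; rewrite -lev; exact: hat_path_atE.
have [cE|cE] := eqVneq c (h v).
  exists v, [::]; split => //.
    by have [lk _ _] := single cE; exact: (linked_from_crit Cv lk).
  by move=> j; have [_ ? ?] := levelP j; exfalso; lra.
have clt : c < h v by rewrite lt_neqAle cE.
have Vv : crit_value h (h v) by exists v.
(* The strand built so far ends on the orbit of the section at level [d] and passes through every
   section from [d] upwards; each step appends one link. *)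
have prefix : forall d, crit_levels h c (h v) d -> forall i : levels, set_val i = d ->
    exists u g, [/\ Crit h u, broken h Phi v u g, unstable Phi u (z.1 i) &
      forall j : levels, d <= set_val j -> strand Phi v g (z.1 i) (z.1 j)].
  apply: (crit_levels_ind LF Vv) => [i iv|d d1 nb cd1 dv IH j jd1].
    have [lk _ _] := top _ iv.
    exists v, [::]; split => //; first exact: (linked_from_crit Cv lk).
    move=> j vj; have -> : j = i.
      have [_ _ jv] := levelP j; apply: val_inj.
      suff : set_val j = set_val i by [].
      by apply/eqP; rewrite eq_le iv jv vj.
    by right; exact: (flow_orbit_refl LF).
  have [Vd1 Vd d1d _] := nb.
  have di : crit_levels h c (h v) d by split => //; apply/andP; split; lra.
  pose i : levels := SigSub (mem_set di).
  have [u [g [Cu bg ui gi]]] := IH i erefl.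
  have [|lk _ _] := step i j; first by rewrite jd1.
  have Cx := level_not_crit (lev i).
  have [u' [g' [Cu' bg' u'j sub]]] := strand_extend Cu bg ui Cx (linked_orbit lk).
  exists u', g'; split => // k dk.
  have [Vk _ kv] := levelP k.
  have [kd|kd] := leP d (set_val k); first exact/sub/gi.
  have -> : k = j; last by right; exact: (flow_orbit_refl LF).
  apply: val_inj; suff : set_val k = set_val j by [].
  apply/eqP; rewrite eq_le jd1 dk andbT leNgt; apply/negP => lt.
  by have [_ _ _ /(_ _ Vk)] := nb; rewrite lt kd.
have [d nb dv] := next_above_ex LF Vc Vv clt.
have [_ Vd cd _] := nb.
have di : crit_levels h c (h v) d by split => //; apply/andP; split.
pose i : levels := SigSub (mem_set di).
have [u [g [Cu bg ui gi]]] := prefix d di i erefl.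
have all_i (j : levels) : d <= set_val j.
  have [Vj cj _] := levelP j.
  by have [_ _ _ /(_ _ Vj)] := nb; rewrite cj /= -leNgt.
have Cx := level_not_crit (lev i).
have ext : (exists t, z.2 = Phi t (z.1 i)) \/
    (exists u', [/\ Crit h u', stable Phi u' (z.1 i) & unstable Phi u' z.2]) ->
    exists u g, [/\ Crit h u, broken h Phi v u g, unstable Phi u z.2 &
      forall j, strand Phi v g z.2 (z.1 j)].
  move=> /(strand_extend Cu bg ui Cx)[u' [g' [Cu' bg' u'j sub]]].
  by exists u', g'; split => // k; exact/sub/gi.
have [[lk _ _]|[lk _ _]] := bot i nb; first exact/ext/linked_orbit.
(* The end point lies above the lowest section, so the link is followed backwards. A break [u2]
   would have its value between [set_val i - eps] and [b], where there is no critical value. *)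
case: lk => [[t [_ /= zt]]|[u2 [Cu2 /= zu2 u2z]]].
  by apply: ext; left; exists (- t); rewrite zt (flowK LF).
have Vu2 : crit_value h (h u2) by exists u2.
have lt1 := unstable_lt LF u2z Cx; rewrite lev in lt1.
have lt2 := stable_ge LF 0 zu2; rewrite (flow0 LF) in lt2.
have lt3 := bnd _ nb; have e0 := eps_gt0.
have : set_val i <= h u2 by apply: level_gap => //; lra.
rewrite -[set_val i]/d; lra.
Qed.


Section window.
Variables a b : R.
Hypothesis window_le : forall e, crit_value h e -> e <= b -> e <= c.
Hypothesis window_ge : forall e, crit_value h e -> a <= e -> c <= e.

Lemma level_gt_window (i : levels) : b < set_val i.
Proof.
have [Vi ci _] := levelP i; rewrite ltNge; apply/negP => /(window_le Vi).
by rewrite leNgt ci.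
Qed.

Lemma hat_hE (p : hatW h Phi v) : h (hat_i p) = hat_h p.
Proof. by []. Qed.

(** If the end point lies above the section, its forward orbit takes over. It reaches the section
    because no critical value lies between the two levels. *)
Lemma strand_at_level (p : hatW h Phi v) (i : levels) : a <= hat_h p <= b ->
  exists2 y, strand Phi v (set_val (hw_path p)) (hat_i p) y & h y = set_val i - eps.
Proof.
move=> /andP[ap pb]; have [Vi ci iv] := levelP i; have e0 := eps_gt0.
have ux := hw_ptP (p := p); have bg := hw_pathP p.
have [xi|ix] := leP (hat_h p) (set_val i - eps).
  by apply: (strand_level LF bg ux); rewrite hat_hE xi /=; lra.
have ic := level_lt i.
have noC u : Crit h u -> ~~ (set_val i - eps <= h u <= hat_h p).
  move=> Cu; have Vu : crit_value h (h u) by exists u.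
  apply/negP => /andP[iu up]; have := level_gap (i := i) Vu.
  have := level_gt_window i => ? H; have : set_val i <= h u by apply: H; lra.
  lra.
have Cx : ~ Crit h (hat_i p).
  by move=> /noC; rewrite hat_hE lexx (ltW ix).
have [||t _ ht] := orbit_down LF Cx (s := set_val i - eps).
- exact: ltW.
- by move=> u /noC; apply: contra => /andP[-> /ltW].
by exists (Phi t (hat_i p)) => //; right; exists t.
Qed.

Lemma section_strand (p : hatW h Phi v) (i : levels) : a <= hat_h p <= b ->
  strand Phi v (set_val (hw_path p)) (hat_i p) ((section p).1 i) /\
  h ((section p).1 i) = set_val i - eps.
Proof.
move=> pab; have [y Ty hy] := strand_at_level i pab.
by rewrite /section /= -hy (hat_path_atE LF Ty).
Qed.

(** Each condition is [strand_linked] over an interval whose only possible critical value is [h v],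
    the level of the lower section, or [c]. *)
Lemma section_chains (p : hatW h Phi v) : a <= hat_h p <= b -> chains a b (section p).
Proof.
move=> pab; have ux := hw_ptP (p := p); have bg := hw_pathP p.
have T i := (section_strand i pab).1; have lev i := (section_strand i pab).2.
rewrite [section p]surjective_pairing; move: (section p).1 T lev => z1 T lev.
have Vv : crit_value h (h v) by exists v.
have Tv : strand Phi v (set_val (hw_path p)) (hat_i p) v.
  by left; exact: path_trace_head.
have Tx : strand Phi v (set_val (hw_path p)) (hat_i p) (hat_i p).
  by right; exact: (flow_orbit_refl LF).
have [ap pb] := andP pab; have e0 := eps_gt0.
have lk y z d : strand Phi v (set_val (hw_path p)) (hat_i p) y ->
    strand Phi v (set_val (hw_path p)) (hat_i p) z -> h z <= h y ->
    (forall e, crit_value h e -> h z <= e <= h y -> e = d) -> linked Phi (Crit h) y z.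
  move=> Ty Tz zy H; apply: (strand_linked LF Cv bg ux Ty Tz zy).
  by move=> e e' Ve Ve' /(H _ Ve) -> /(H _ Ve') ->.
split => [//|i iv|i j nb|i nb|] /=.
- split => /=; last by [].
    apply: (lk _ _ (h v)) => //; first by rewrite lev iv; lra.
    move=> e Ve /andP[ie ev]; apply/eqP; rewrite eq_le ev -iv level_gap//.
    by move: ie; rewrite lev; lra.
  by rewrite lev iv.
- have [_ _ ji _] := nb.
  have ij : set_val j < set_val i - 2 * eps.
    by case: epsP => _ /(_ (set_val i) _ (set_mem (valP i)) nb).
  split; rewrite /= ?lev//; apply: (lk _ _ (set_val j)) => //; rewrite !lev; first lra.
  move=> e Ve /andP[je ei]; apply/eqP; rewrite eq_le level_gap//; last lra.
  by rewrite andbT leNgt; apply/negP => lt; have [_ _ _ /(_ _ Ve)] := nb; rewrite lt/=; lra.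
- have bi := level_gt_window i.
  have [xi|ix] := leP (hat_h p) (set_val i - eps); [left|right].
    split; rewrite /= ?lev//; apply: (lk _ _ c) => //; rewrite !lev//.
    move=> e Ve /andP[xe ei]; apply/eqP; rewrite eq_le window_ge ?andbT//; last first.
      exact: le_trans ap xe.
    by rewrite leNgt; apply/negP => lt; have [_ _ _ /(_ _ Ve)] := nb; rewrite lt/=; lra.
  split; rewrite /= ?lev//; apply: (lk _ _ c) => //; rewrite !lev//; first exact: ltW.
  move=> e Ve /andP[ie ex]; have := level_gap (i := i) Ve => H.
  have : set_val i <= e by apply: H; lra.
  by rewrite /= hat_hE in ex; lra.
- split => // cE; split => //=.
  have [xv _] := strand_le LF bg ux Tx; apply: (lk _ _ c) => //.
  move=> e Ve /andP[xe ev]; apply/eqP; rewrite eq_le cE ev -cE window_ge//.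
  exact: le_trans ap xe.
Qed.

Lemma closed_linked_in a' b' d :
  (forall e, crit_value h e -> a' <= e <= b' -> e = d) -> closed (linked_in a' b').
Proof.
move=> H; apply: (closed_linked LF) => u u' Cu Cu' /H -> => [/H -> //|]; by [exists u'|exists u].
Qed.

Lemma closed_preimage2 (f g : sections * M -> M) (D : set (M * M)) :
  continuous f -> continuous g -> closed D -> closed [set z | D (f z, g z)].
Proof.
move=> cf cg clD; apply: (@closed_comp _ _ (fun z => (f z, g z)) D) => // z _.
exact: (continuous_pair cf cg).
Qed.

Lemma section_proj_continuous (i : levels) : continuous (fun z : sections * M => z.1 i).
Proof.
move=> z; have H1 : {for z, continuous (fst : sections * M -> sections)} by exact: cvg_fst.
exact: (continuous_comp H1
  (@proj_continuous _ (fun _ : levels => (M : topologicalType)) i z.1)).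
Qed.

Lemma closed_chains : closed (chains a b).
Proof.
have pc := section_proj_continuous.
have c2 : continuous (fun z : sections * M => z.2) by move=> z; exact: cvg_snd.
have cc y : continuous (fun _ : sections * M => y : M) by move=> z; exact: cvg_cst.
have ch (f : sections * M -> M) : continuous f -> continuous (h \o f).
  by move=> cf z; apply: continuous_comp; [exact: cf|exact: (lyap_continuous LF)].
have ccl (f : sections * M -> R) (D : set R) : continuous f -> closed D ->
    closed [set z | D (f z)].
  by move=> cf clD; apply: (@closed_comp _ _ f D) => // z _; exact: cf.
have e0 := eps_gt0.
(* A condition guarded by a premise independent of [z] becomes an intersection over the indices
   satisfying the premise; the index type [unit] serves the premise [c = h v]. *)
have -> : chains a b =
  (\bigcap_i [set z | h (z.1 i) = set_val i - eps]) `&`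
  (\bigcap_(i in [set i : levels | set_val i = h v])
     [set z | linked_in (h v - eps) (h v) (v, z.1 i)]) `&`
  (\bigcap_(ij in [set ij : levels * levels | next_below h (set_val ij.2) (set_val ij.1)])
     [set z | linked_in (set_val ij.2 - eps) (set_val ij.1 - eps) (z.1 ij.1, z.1 ij.2)]) `&`
  (\bigcap_(i in [set i : levels | next_below h c (set_val i)])
     ([set z | linked_in a (set_val i - eps) (z.1 i, z.2)] `|`
      [set z | linked_in (set_val i - eps) b (z.2, z.1 i)])) `&`
  ([set z | a <= h z.2] `&` [set z | h z.2 <= b] `&`
   \bigcap_(_ in [set _ : unit | c = h v]) [set z | linked_in a (h v) (v, z.2)]).
  apply/seteqP; split => z.
    move=> [H1 H2 H3 H4 [H5 H6 H7]].
    split; [split; [split; [split|]|]|].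
    + by move=> i _; exact: H1.
    + by move=> i; exact: H2.
    + by move=> [i j]; exact: H3.
    + by move=> i; exact: H4.
    + by split; [split; [exact: H5|exact: H6]|move=> [] cE; exact: H7].
  move=> [[[[H1 H2] H3] H4] [[H5 H6] H7]]; split.
  + by move=> i; exact: H1.
  + by move=> i; exact: H2.
  + by move=> i j; exact: (H3 (i, j)).
  + by move=> i; exact: H4.
  + by split; [exact: H5|exact: H6|move=> cE; exact: (H7 tt)].
repeat apply: closedI.
- apply: closed_bigI => i _; exact: (ccl _ _ (ch _ (pc i)) (@closed_eq R (set_val i - eps))).
- apply: closed_bigI => i iv; apply: closed_preimage2 => //.
  apply: (@closed_linked_in _ _ (h v)) => e Ve /andP[ie ev].
  by apply/eqP; rewrite eq_le ev -iv level_gap// iv; lra.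
- apply: closed_bigI => -[i j] /= nb; apply: closed_preimage2 => //.
  apply: (@closed_linked_in _ _ (set_val j)) => e Ve /andP[je ei].
  apply/eqP; rewrite eq_le level_gap ?andbT//; last lra.
  by rewrite leNgt; apply/negP => lt; have [_ _ _ /(_ _ Ve)] := nb; rewrite lt/=; lra.
- apply: closed_bigI => i nb; have bi := level_gt_window i; apply: closedU.
    apply: closed_preimage2 => //; apply: (@closed_linked_in _ _ c) => e Ve /andP[ae ei].
    apply/eqP; rewrite eq_le window_ge// andbT.
    by rewrite leNgt; apply/negP => lt; have [_ _ _ /(_ _ Ve)] := nb; rewrite lt/=; lra.
  apply: closed_preimage2 => //; apply: (@closed_linked_in _ _ c) => e Ve /andP[ie eb].
  have H := level_gap (i := i) Ve; have : set_val i <= e by apply: H; lra.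
  lra.
- exact: (ccl _ _ (ch _ c2) (@closed_ge R a)).
- exact: (ccl _ _ (ch _ c2) (@closed_le R b)).
- apply: closed_bigI => -[] cE; apply: closed_preimage2 => //.
  apply: (@closed_linked_in _ _ c) => e Ve /andP[ae ev].
  by apply/eqP; rewrite eq_le window_ge// cE ev.
Qed.

Lemma compact_chains : compact (chains a b).
Proof.
pose B1 : set sections :=
  [set f | forall i, [set x | set_val i - eps <= h x <= set_val i - eps] (f i)].
have cB1 : compact B1.
  exact: (@tychonoff _ (fun _ : levels => (M : topologicalType)) _
    (fun i => lyap_proper LF (set_val i - eps) (set_val i - eps))).
apply: (subclosed_compact closed_chains (compact_setX cB1 (lyap_proper LF a b))).
move=> z [lev _ _ _ [az zb _]]; split => /=; last by rewrite az.
by move=> i /=; rewrite lev lexx.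
Qed.

End window.

End chains.

(** Open sets of the source are preimages under [f], so any preimage of a cluster point of the image
    filter is a cluster point. *)
Lemma compact_initial (S : choiceType) (T : topologicalType) (f : S -> T) :
  compact (range f) -> compact [set: initial_topology f].
Proof.
move=> cf F FF _.
pose G : set_system T := f @ F.
have FG : ProperFilter G by exact: fmap_proper_filter.
have GR : F (f @^-1` range f) by apply: filterS filterT => y _; exists y.
have [_ [[x _ <-] fx]] := cf G FG GR.
exists x; split => // A B FA; rewrite nbhsE => -[B' [[D oD <-] /= Dx] B'B].
have GA : F (f @^-1` (f @` A)) by apply: filterS FA => y Ay; exists y.
have [y [[a Aa <-] Da]] := fx _ D GA (open_nbhs_nbhs (conj oD Dx)).
by exists a; split => //; exact: B'B.
Qed.

Lemma hausdorff_initial (S : choiceType) (T : topologicalType) (f : S -> T) :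
  injective f -> hausdorff_space T -> hausdorff_space (initial_topology f).
Proof.
move=> injf hT x y xy; apply: injf; apply: contrapT => fxy.
have [A [B [ [oA Ax] [ oB By] AB]]] := hausdorff_separate hT fxy.
have cf : continuous (f : initial_topology f -> T) by exact: initial_continuous.
have [z [Az Bz]] := xy _ _ (cf x A (open_nbhs_nbhs (conj oA Ax)))
  (cf y B (open_nbhs_nbhs (conj oB By))).
exact: AB Az Bz.
Qed.

(** * A broken trajectory is determined by its points at noncritical levels *)

Section broken_inj.
Context {R : realType} {n : nat} {M : manifold R n}.
Variables (h : M -> R) (Phi : R -> M -> M).
Hypothesis LF : lyapunov_flow h Phi (Crit h).

(** Everything from the vertex [u1] onwards lies at or below [h u1], hence at or below the critical
    value preceding [h v]. *)
Lemma broken_first v u o u1 g y : Crit h v -> broken h Phi v u ((o, u1) :: g) ->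
  path_trace v ((o, u1) :: g) y -> h y < h v ->
  (forall d, next_below h d (h v) -> d < h y) -> o y.
Proof.
move=> Cv [Cu1 [_ u1v] vo bg] gy yv dy.
have Vv : crit_value h (h v) by exists v.
have Vu1 : crit_value h (h u1) by exists u1.
have [d nb u1d] := next_below_ex LF Vu1 Vv u1v.
have {nb} dy := dy _ nb.
case: gy => [[yE|//]|gy]; first by move: yv; rewrite yE ltxx.
have [yu1 _] : h y <= h u1 /\ (h y = h u1 -> y = u1).
  apply: (strand_le LF bg (unstable_crit LF _)); last by left.
  by elim: (g) (u1) Cu1 bg => [|[ o' u2] g' IH] u' Cu' /= => [<-|[Cu2 _ _ /IH]]; last exact.
by have := le_lt_trans (le_trans yu1 u1d) dy; rewrite ltxx.
Qed.

(** A common point just below [h v] determines the first trajectory, and the forward limit of that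
    point determines the next vertex. For the remaining lists, common points below later critical
    values cannot lie on the trajectory already removed, which is too high. *)
Lemma broken_inj v u g g' : Crit h v -> broken h Phi v u g -> broken h Phi v u g' ->
  (forall d, crit_levels h (h u) (h v) d -> exists y, [/\ path_trace v g y,
     path_trace v g' y, h y < d & forall d', next_below h d' d -> d' < h y]) -> g = g'.
Proof.
elim: g v g' => [|[ o u1] g IH] v [|[ o' u1'] g'] Cv bg bg' common //.
- move: bg bg' => /= -> [_ [_ lt] _ /(broken_le)].
  by rewrite leNgt lt.
- move: bg' bg => /= -> [_ [_ lt] _ /(broken_le)].
  by rewrite leNgt lt.
have [Cu1 [_ u1v] vo bg1] := bg; have [Cu1' [_ u1v'] vo' bg1'] := bg'.
have uu1 := broken_le bg1; have uu1' := broken_le bg1'.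
have vlev : crit_levels h (h u) (h v) (h v).
  by split; [exists v|rewrite lexx andbT (le_lt_trans uu1)].
have [y [gy gy' yv dy]] := common _ vlev.
have oy := broken_first Cv bg gy yv dy; have oy' := broken_first Cv bg' gy' yv dy.
have [oE _ yu1] := TrajP LF vo oy; have [oE' _ yu1'] := TrajP LF vo' oy'.
have uE := stable_unique LF yu1 yu1'.
rewrite -{}uE in bg' bg1' vo' common gy' *.
rewrite oE oE'; congr cons; apply: (IH u1) => // d [Vd /andP[ud du1]].
have dv := le_lt_trans du1 u1v.
have [|z [gz gz' zd dz]] := common d.
  by split => //; rewrite ud (ltW dv).
exists z; split => //.
- case: gz => [[zE|oz]|//]; first by move: (lt_trans zd dv); rewrite zE ltxx.
  have /andP[uz _] := Traj_lt LF vo u1v oz.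
  by have := lt_le_trans (lt_trans uz zd) du1; rewrite ltxx.
- case: gz' => [[zE|oz]|//]; first by move: (lt_trans zd dv); rewrite zE ltxx.
  have /andP[uz _] := Traj_lt LF vo' u1v oz.
  by have := lt_le_trans (lt_trans uz zd) du1; rewrite ltxx.
Qed.

Lemma hatW_eq v (p q : hatW h Phi v) : hw_end p = hw_end q ->
  set_val (hw_path p) = set_val (hw_path q) -> hat_i p = hat_i q -> p = q.
Proof.
case: p q => u Cu uv g x [u' Cu' uv' g' x'] /= uu'; subst u' => /val_inj gg'.
rewrite /hat_i /= => /val_inj xx'; subst g' x'.
by congr HatW; exact: Prop_irrelevance.
Qed.

(** Linkage applies with a vacuous uniqueness condition, and a break would itself be a critical
    point between the two levels. *)
Lemma strand_orbit v u g x y z : Crit h v -> broken h Phi v u g -> unstable Phi u x ->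
  strand Phi v g x y -> strand Phi v g x z ->
  (forall e, crit_value h e -> h y <= e <= h z \/ h z <= e <= h y -> False) ->
  flow_orbit Phi z y.
Proof.
move=> Cv bg ux Ty Tz noC.
wlog zy : y z Ty Tz noC / h z <= h y.
  move=> H; have [|/ltW yz] := leP (h z) (h y); first exact: H.
  have [|t _ <-] := H z y Tz Ty _ yz; first by move=> e Ve [?|?]; apply: (noC e Ve); [right|left].
  by exists (- t); rewrite // (flowK LF).
have lk : linked Phi (Crit h) y z.
  apply: (strand_linked LF Cv bg ux Ty Tz zy) => e e' Ve _ ze _.
  by exfalso; apply: (noC e Ve); right.
case: lk => [[t [_ ->]]|[u' [Cu' yu' u'z]]].
  by exists (- t); rewrite // (flowK LF).
exfalso; apply: (noC (h u')); first by exists u'.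
have := stable_ge LF 0 yu'; have := unstable_le LF 0 u'z.
by rewrite !(flow0 LF) => -> ->; right.
Qed.

End broken_inj.

(** * Compactness and separation of B(v, w) *)

Section bspace.
Context {R : realType} {n : nat} {M : manifold R n}.
Variables (h : M -> R) (Phi : R -> M -> M).
Hypothesis LF : lyapunov_flow h Phi (Crit h).
Hypothesis index_drop : forall v w x, Crit h v -> Crit h w -> v <> w ->
  unstable Phi v x -> stable Phi w x -> (morse_index h w < morse_index h v)%N.
Variables (v w : M) (eps : R).
Hypotheses (Cv : Crit h v) (Cw : Crit h w) (wv : crit_le h w v).
Hypothesis epsP : eps_small h (h w) (h v) eps.

Local Notation levels := (set_type (crit_levels h (h w) (h v))).
Local Notation sections := (prod_topology (fun _ : levels => (M : topologicalType))).

Let Vw : crit_value h (h w). Proof. by exists w. Qed.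
Let wv_le : h w <= h v. Proof. by case: wv => [[_ /ltW]|->]. Qed.
Let window e : crit_value h e -> e <= h w -> e <= h w. Proof. by []. Qed.
Let window' e : crit_value h e -> h w <= e -> h w <= e. Proof. by []. Qed.

(* B(v, w) is the fibre over [w] of the map from \hat W^-_v to M. *)
Definition fiber_point (g : set_type (B h Phi v w)) : hatW h Phi v :=
  HatW Cw wv g (SigSub (mem_set (unstable_crit LF Cw))).

Lemma fiber_strand (g : set_type (B h Phi v w)) :
  strand Phi v (set_val g) w = path_trace v (set_val g).
Proof.
rewrite /strand; apply/seteqP; split => [y [//|[t _ <-]]|y]; last by left.
rewrite (flow_fixed LF)//; apply: path_trace_last; exact: set_mem (valP g).
Qed.

Lemma fiber_J (g : set_type (B h Phi v w)) (i : levels) :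
  path_trace v (set_val g) (J eps g i) /\ h (J eps g i) = set_val i - eps.
Proof.
have := section_strand LF Vw epsP window (p := fiber_point g) i (a := h w).
rewrite -[hat_h _]/(h w) lexx => /(_ isT)[].
rewrite -[hat_i _]/w -[set_val (hw_path _)]/(set_val g) fiber_strand => gy hy.
have bg : broken h Phi v w (set_val g) by exact: set_mem (valP g).
by rewrite /J -hy (path_atE LF bg Cw gy).
Qed.

Lemma section_fiber (g : set_type (B h Phi v w)) :
  section (h w) eps (fiber_point g) = (J eps g, w).
Proof.
rewrite /section; congr pair; apply/funext => i.
have [gy hy] := fiber_J g i; rewrite -hy; apply: (hat_path_atE LF).
by left.
Qed.

Lemma J_inj : injective (@J _ _ _ h Phi eps v w).
Proof.
move=> g g' gg'; apply: val_inj.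
apply: (broken_inj LF Cv (set_mem (valP g)) (set_mem (valP g'))) => d dlev.
pose i : levels := SigSub (mem_set dlev).
have [gy hy] := fiber_J g i; have [gy' _] := fiber_J g' i.
exists (J eps g i); rewrite {2}gg'; split => //; rewrite hy.
  by rewrite -[set_val i]/d; case: epsP => ? _; lra.
move=> d' nb; case: epsP => e0 /(_ _ _ dlev nb).
by rewrite -[set_val i]/d; lra.
Qed.

(** Here the window [[a, b]] shrinks to the single level [h w]. The condition [z.2 = w] selects the
    fibre: a critical point is its own backward limit, so the end of the strand is [w] itself. *)
Lemma range_J : range (@J _ _ _ h Phi eps v w) =
  fst @` (@chains _ _ _ h Phi v (h w) eps (h w) (h w) `&` [set z | z.2 = w]).
Proof.
apply/seteqP; split => [_ [g _ <-]|_ [[q x] [ch /= xw] <-]]; last subst x.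
  exists (J eps g, w) => //; split => //; rewrite -section_fiber.
  apply: (section_chains LF Cv Vw epsP window window').
  by rewrite -[hat_h _]/(h w) lexx.
have [|p pE] := chains_section LF index_drop Cv Vw wv_le epsP ch; first by move=> d [].
have pw : hat_i p = w by rewrite -[RHS]/((q, w).2) -pE.
have uw : w = hw_end p.
  by apply: (unstable_crit_eq LF Cw); rewrite -pw; exact: hw_ptP.
have gP : B h Phi v w (set_val (hw_path p)) by rewrite [X in B _ _ _ X]uw; exact: hw_pathP.
pose g : set_type (B h Phi v w) := SigSub (mem_set gP).
have gp : fiber_point g = p by apply: hatW_eq; rewrite ?pw.
by exists g => //; have := section_fiber g; rewrite gp pE => -[->].
Qed.

Lemma Bspace_compact : compact [set: Bspace h Phi eps v w].
Proof.
apply: compact_initial; rewrite range_J; apply: continuous_compact.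
  by apply: continuous_subspaceT => z; exact: cvg_fst.
have cch := compact_chains LF epsP window window'.
apply: subclosed_compact cch _; last by move=> z [].
apply: closedI.
  exact: (closed_chains LF epsP window window').
have clw : closed [set w].
  by apply: compact_closed; [exact: (lyap_hausdorff LF)|exact: compact_set1].
apply: (@closed_comp _ _ (fun z : sections * M => z.2) [set w]) => // z _.
exact: cvg_snd.
Qed.

Lemma Bspace_hausdorff : hausdorff_space (Bspace h Phi eps v w).
Proof.
apply: hausdorff_initial; first exact: J_inj.
by apply: hausdorff_product => i; exact: (lyap_hausdorff LF).
Qed.

End bspace.

(** * The space W-hat *)

Section hatW_space.
Context {R : realType} {n : nat} {M : manifold R n}.
Variables (h : M -> R) (Phi : R -> M -> M).
Hypothesis LF : lyapunov_flow h Phi (Crit h).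
Hypothesis index_drop : forall v w x, Crit h v -> Crit h w -> v <> w ->
  unstable Phi v x -> stable Phi w x -> (morse_index h w < morse_index h v)%N.
Variables (v : M) (eps del : R -> R).
Hypotheses (Cv : Crit h v) (constP : hatW_constants h eps del v).
Local Notation W := (hatWspace h Phi eps del v).

Lemma band_le c s e : crit_value h c -> c <= h v -> band h c (del c) s ->
  crit_value h e -> e <= s -> e <= c.
Proof.
move=> Vc cv [_ sP] Ve es; rewrite leNgt; apply/negP => ce.
have [d nb de] := next_above_ex LF Vc Ve ce.
have := sP _ nb; have [_ [d0 _ _]] := constP Vc cv; lra.
Qed.

Lemma band_ge c s e : crit_value h c -> c <= h v -> band h c (del c) s ->
  crit_value h e -> s <= e -> c <= e.
Proof.
move=> Vc cv [sP _] Ve se; rewrite leNgt; apply/negP => ec.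
have [d nb de] := next_below_ex LF Ve Vc ec.
have := sP _ nb; have [_ [d0 _ _]] := constP Vc cv; lra.
Qed.

(** Since [del] is below half of each adjacent gap, the bands of two consecutive critical values
    both contain the midpoint of the gap in their interior. The midpoint decides which band to use;
    a critical level [s] lies inside its own band. *)
Lemma band_window s : s <= h v -> exists c a b, [/\ crit_value h c /\ c <= h v,
  a < s, s < b & forall s', a <= s' <= b -> band h c (del c) s'].
Proof.
move=> sv.
have [|hi [Vhi /andP[shi hiv]] himin] := finite_set_min (finite_crit_value LF s (h v)).
  by exists (h v); rewrite /= lexx sv; split => //; exists v.
have min e : crit_value h e -> e < hi -> e < s.
  move=> Ve ehi; rewrite ltNge; apply/negP => se.
  have : hi <= e by apply: himin; split => //; rewrite se (le_trans (ltW ehi)).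
  by rewrite leNgt ehi.
have [_ [d0 dlo dup]] := constP Vhi hiv.
move: shi; rewrite le_eqVlt => /predU1P[sE|shi].
  exists hi, (hi - del hi), (hi + del hi); split; rewrite ?sE //; try lra.
  move=> s' /andP[s'1 s'2]; split => d nb; [have := dlo _ nb|have := dup _ nb]; lra.
have up s' d : s' <= hi -> next_below h hi d -> s' <= d - del hi.
  by move=> s'hi nb; have := dup _ nb; have [_ _ ? _] := nb; lra.
have [[e [Ve ehi]]|noe] := pselect (exists e, crit_value h e /\ e < hi); last first.
  exists hi, (s - 1), hi; split => //; first lra.
  move=> s' /andP[s'1 s'2]; split => d nb; last exact: up.
  by exfalso; apply: noe; exists d; case: nb.
have [d nb _] := next_below_ex LF Ve Vhi ehi.
have [Vd _ dhi _] := nb.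
have uniq d' : next_below h d' hi -> d' = d.
  move=> [Vd' _ d'hi nd']; have [_ _ _ nd] := nb; apply/eqP; rewrite eq_le.
  by have := nd _ Vd'; have := nd' _ Vd; rewrite d'hi dhi !andbT -!leNgt => -> ->.
have dv : d <= h v by lra.
have [_ [dd0 ddlo ddup]] := constP Vd dv.
have H1 := dlo _ nb; have H2 := ddup _ nb.
have [sm|sm] := leP ((d + hi) / 2) s.
  exists hi, (d + del hi), hi; split => //; first lra.
  move=> s' /andP[s'1 s'2]; split => d' nb'; last exact: up.
  by rewrite (uniq _ nb').
have ds := min _ Vd dhi.
exists d, d, (hi - del d); split => //; first lra.
move=> s' /andP[s'1 s'2]; split => d' nb'; first by have := ddlo _ nb'; lra.
have [_ Vd' dd' nd'] := nb'; have [_ _ _ nd] := nb.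
have : hi <= d'.
  by have := nd _ Vd'; rewrite dd' /= -leNgt.
lra.
Qed.

Lemma open_hatWP (A : set W) : open A <-> hatW_open A.
Proof. by []. Qed.

Section part.
Variable c : R.
Hypotheses (Vc : crit_value h c) (cv : c <= h v).
Local Notation levels := (set_type (crit_levels h c (h v))).
Local Notation sections := (prod_topology (fun _ : levels => (M : topologicalType))).

Lemma part_open (A : set (hatW h Phi v)) (D : set (sections * M)) : open D ->
  (forall p, band h c (del c) (hat_h p) -> A p <-> D (section c (eps c) p)) ->
  open ((fun p : set_type (@hatW_band _ _ _ h Phi v (del c) c) => set_val p) @^-1` A
          : set (hatW_part h Phi (eps c) (del c) v c)).
Proof.
move=> oD AD; exists D => //; apply/seteqP; split => p /=.
  by move=> Dp; apply/AD => //; exact: set_mem (valP p).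
by move=> Ap; apply/AD => //; exact: set_mem (valP p).
Qed.

Lemma section_snd_continuous : continuous (fun z : sections * M => z.2).
Proof. by move=> z; exact: cvg_snd. Qed.

End part.

Lemma hat_i_continuous : continuous (@hat_i _ _ _ h Phi v : W -> M).
Proof.
apply/continuousP => A oA; apply/open_hatWP => c Vc cv.
have c2 : continuous (fun z : prod_topology
    (fun _ : set_type (crit_levels h c (h v)) => (M : topologicalType)) * M => z.2).
  by move=> z; exact: cvg_snd.
exists (snd @^-1` A); last by [].
by apply: open_comp => // z _; exact: c2.
Qed.

Lemma hat_h_continuous : continuous (@hat_h _ _ _ h Phi v : W -> R).
Proof.
move=> p; apply: continuous_comp; first exact: hat_i_continuous.
exact: (lyap_continuous LF).
Qed.

(** At a noncritical level the orbit of [z] is strictly above [s] at time [t - e] and strictly below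
    at [t + e]. Both inequalities persist nearby, and the whole time window keeps the crossing
    inside [U]. *)
Lemma flow_slice_open s (U : set M) : (forall e, crit_value h e -> e <> s) -> open U ->
  open [set z | exists t, h (Phi t z) = s /\ U (Phi t z)].
Proof.
move=> sP oU; rewrite openE => z [t [hz Uz]].
have Cz : ~ Crit h z.
  move=> Cz; apply: (sP (h z)); first by exists z.
  by rewrite -hz (flow_fixed LF).
have [e e0 eU] : exists2 e, 0 < e & \forall z' \near z,
    forall r, 0 <= r <= 2 * e -> U (Phi (t - e + r) z').
  have [[P Q] [/= tP zQ] PQ] : nbhs (t, z) ((fun z => Phi z.1 z.2) @^-1` U).
    by apply: (flow_continuous LF (t, z)); exact: open_nbhs_nbhs.
  have [e /= e0 eP] := tP.
  exists (e / 2); first by rewrite divr_gt0.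
  apply: filterS zQ => z' Qz' r /andP[r0 re]; apply: (PQ (t - e / 2 + r, z')).
  split => //=; apply: eP; rewrite /ball_ /= ltr_norml; apply/andP; split; lra.
have c r : continuous (fun z => h (Phi r z)).
  by move=> y; apply: (continuous_comp (@flow_continuous_space _ _ _ _ _ LF r y)
    (lyap_continuous LF _)).
have H1 : nbhs (h (Phi (t - e) z)) [set s' | s < s'].
  by apply: lt_nbhsr; rewrite -hz; apply: (lyap_decr LF Cz); lra.
have H2 : nbhs (h (Phi (t + e) z)) [set s' | s' < s].
  by apply: lt_nbhsl; rewrite -hz; apply: (lyap_decr LF Cz); lra.
apply: filterS3 eU (c _ z _ H1) (c _ z _ H2) => z' eU /= lt1 lt2.
have [||r /andP[r1 r2] hr] := @orbit_level _ _ _ _ _ LF z' (t - e) (t + e) s; first lra.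
  by rewrite (ltW lt1) (ltW lt2).
exists r; split => //; have -> : r = t - e + (r - (t - e)) by lra.
by apply: eU; apply/andP; split; lra.
Qed.

(** The open sets that tell apart paths with a common end point. The bound on [hat_h p] keeps level
    [s] on the path itself, not on its forward prolongation. *)
Definition path_slice s (U : set M) : set W :=
  [set p | hat_h p < s /\ U (hat_path_at p s)].

Lemma path_slice_point s (p : hatW h Phi v) : hat_h p < s -> s <= h v ->
  strand Phi v (set_val (hw_path p)) (hat_i p) (hat_path_at p s) /\ h (hat_path_at p s) = s.
Proof.
move=> ps sv.
have [|y Ty hy] := strand_level LF (hw_pathP p) (hw_ptP (p := p)) (s := s).
  by rewrite -[h _]/(hat_h p) (ltW ps).
by rewrite -hy (hat_path_atE LF Ty).
Qed.

Lemma flow_sliceP s (U : set M) y z : h y = s -> flow_orbit Phi z y ->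
  U y <-> exists t, h (Phi t z) = s /\ U (Phi t z).
Proof.
move=> hy [t _ ty]; split => [Uy|[t' [ht' Ut']]]; first by exists t; rewrite ty.
by rewrite -ty; rewrite (lyap_inj_orbit LF (s := t) (t := t')) // ty hy ht'.
Qed.

(** Openness is checked on each part. For [d < c] the band lies above [s] and the slice is empty.
    For [c = d] the end point lies on the same orbit as the path at level [s]. For [c < d] the
    section just below [d] does, as no critical value lies between. In the last two cases
    [flow_slice_open] applies. *)
Lemma path_slice_open d s (U : set M) : crit_value h d -> d <= h v -> s < d ->
  (forall e, crit_value h e -> s <= e -> d <= e) -> open U -> open (path_slice s U).
Proof.
move=> Vd dv sd sgap oU; apply/open_hatWP => c Vc cv.
have sV e : crit_value h e -> e <> s.
  by move=> Ve es; have := sgap e Ve; rewrite es lexx => /(_ isT); lra.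
have oG := flow_slice_open sV oU.
have sv : s <= h v by lra.
have [epsc [d0 dlo dup]] := constP Vc cv.
have oS : open [set x | h x < s].
  apply: (@open_comp _ _ h [set s' | s' < s]); last exact: open_lt.
  by move=> x _; exact: (lyap_continuous LF).
have [dc|cd] := ltP d c.
  apply: (part_open open0) => p pc; split => // -[ps _].
  have := band_ge Vc cv pc Vd; rewrite /=.
  have [d' nb dd'] := next_below_ex LF Vd Vc dc.
  by have := pc.1 _ nb => ? _; lra.
have [cE|cnd] := eqVneq c d.
  subst d; pose D : set (prod_topology
    (fun _ : set_type (crit_levels h c (h v)) => (M : topologicalType)) * M) :=
    (fun z => z.2) @^-1` ([set x | h x < s] `&`
     [set z | exists t, h (Phi t z) = s /\ U (Phi t z)]).
  have oD : open D.
    by apply: open_comp; [move=> z _; exact: section_snd_continuous|exact: openI].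
  apply: (part_open oD) => p pc; rewrite /path_slice /D /=.
  have orb : hat_h p < s -> flow_orbit Phi (hat_i p) (hat_path_at p s).
    move=> ps; have [Ty hy] := path_slice_point ps sv.
    apply: (strand_orbit LF Cv (hw_pathP p) (hw_ptP (p := p)) Ty).
      by right; exact: (flow_orbit_refl LF).
    rewrite hy => e Ve; rewrite -[h (hat_i p)]/(hat_h p) => H.
    by case: H => /andP[H1 H2]; [|have := band_ge Vc cv pc Ve H1]; lra.
  split => -[ps]; have [_ hy] := path_slice_point ps sv.
    by move/(flow_sliceP U hy (orb ps)).
  by move=> H; split => //; apply/(flow_sliceP U hy (orb ps)).
have {cnd}cd : c < d by rewrite lt_neqAle cnd.
have di : crit_levels h c (h v) d by split => //; rewrite cd dv.
pose i : set_type (crit_levels h c (h v)) := SigSub (mem_set di).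
pose D : set (prod_topology
    (fun _ : set_type (crit_levels h c (h v)) => (M : topologicalType)) * M) :=
  [set z | h z.2 < s] `&`
  [set z | exists t, h (Phi t (z.1 i)) = s /\ U (Phi t (z.1 i))].
have oD : open D.
  apply: openI.
    have c2 := @section_snd_continuous c.
    exact: (open_comp (fun z _ => c2 z) oS).
  have ci := section_proj_continuous (i := i).
  exact: (open_comp (fun z _ => ci z) oG).
apply: (part_open oD) => p pc; rewrite /path_slice /D /= -[h (hat_i p)]/(hat_h p).
have orb : hat_h p < s -> flow_orbit Phi ((section c (eps c) p).1 i) (hat_path_at p s).
  move=> ps; have [Ty hy] := path_slice_point ps sv.
  have wle e : crit_value h e -> e <= hat_h p -> e <= c by exact: (band_le Vc cv pc).
  have [|Tz hz] := section_strand LF Vc epsc wle (p := p) i (a := hat_h p).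
    by rewrite lexx.
  apply: (strand_orbit LF Cv (hw_pathP p) (hw_ptP (p := p)) Ty Tz).
  rewrite hy hz => e Ve; have e0 := eps_gt0 epsc.
  have gap := level_gap LF epsc (i := i) Ve; have iE : set_val i = d by [].
  rewrite iE in gap *.
  have sg := sgap e Ve.
  case=> /andP[H1 H2]; first by have := sg H1; lra.
  have de : d <= e by apply: gap; lra.
  lra.
split => -[ps]; have [_ hy] := path_slice_point ps sv.
  by move/(flow_sliceP U hy (orb ps)).
by move=> H; split => //; apply/(flow_sliceP U hy (orb ps)).
Qed.

Lemma hatW_hausdorff : hausdorff_space W.
Proof.
move=> p q pq.
have ipq : hat_i p = hat_i q.
  apply: contrapT => ne.
  have [A [B [[oA Ap] [ oB Bq] AB]]] := hausdorff_separate (lyap_hausdorff LF) ne.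
  have [r [Ar Br]] := pq _ _ (hat_i_continuous (open_nbhs_nbhs (conj oA Ap)))
    (hat_i_continuous (open_nbhs_nbhs (conj oB Bq))).
  exact: AB Ar Br.
have uE : hw_end p = hw_end q.
  by apply: (unstable_unique LF (hw_ptP (p := p))); rewrite ipq; exact: hw_ptP.
apply: hatW_eq => //.
have bq : broken h Phi v (hw_end p) (set_val (hw_path q)).
  by move: (hw_pathP q); move: (set_val _) => g; rewrite -uE.
apply: (broken_inj LF Cv (hw_pathP p) bq) => d [Vd /andP[ud dv]].
have Vu : crit_value h (h (hw_end p)) by exists (hw_end p) => //; exact: hw_crit.
have [d' nb ud'] := next_below_ex LF Vu Vd ud.
have [_ _ d'd nd'] := nb.
(* The level is noncritical, and above [h (hw_end p)] because [d'] is. So both end points lie below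
   it, and both paths meet it in their broken part rather than on the final orbit. *)
pose s := (d' + d) / 2.
have sd : s < d by rewrite /s; lra.
have d's : d' < s by rewrite /s; lra.
have pu (r : hatW h Phi v) : hw_end r = hw_end p -> h (hat_i r) <= h (hw_end p).
  by move=> <-; have := unstable_le LF 0 (hw_ptP (p := r)); rewrite (flow0 LF).
have ps : hat_h p < s by have := pu _ erefl; rewrite -/(hat_h p) /hat_h /=; lra.
have qs : hat_h q < s by have := pu _ (esym uE); rewrite /hat_h /=; lra.
have sv : s <= h v by lra.
have [Tp hp] := path_slice_point ps sv; have [Tq hq] := path_slice_point qs sv.
have tr (r : hatW h Phi v) : hw_end r = hw_end p ->
    strand Phi v (set_val (hw_path r)) (hat_i r) (hat_path_at r s) ->
    h (hat_path_at r s) = s -> path_trace v (set_val (hw_path r)) (hat_path_at r s).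
  move=> rE [//|[t _ rt]] hs.
  have := unstable_le LF t (hw_ptP (p := r)); rewrite rt hs => su.
  have hE : h (hw_end r) = h (hw_end p) by rewrite rE.
  by move: su; rewrite hE leNgt (le_lt_trans ud' d's).
have pqs : hat_path_at p s = hat_path_at q s.
  apply: contrapT => ne.
  have [A [B [[oA Ap] [ oB Bq] AB]]] := hausdorff_separate (lyap_hausdorff LF) ne.
  have sgap e : crit_value h e -> s <= e -> d <= e.
    move=> Ve se; rewrite leNgt; apply/negP => ed.
    by have := nd' _ Ve; rewrite ed andbT -leNgt; lra.
  have [r [[_ Ar] [_ Br]]] := pq (path_slice s A) (path_slice s B)
    (open_nbhs_nbhs (conj (path_slice_open Vd dv sd sgap oA) (conj ps Ap)))
    (open_nbhs_nbhs (conj (path_slice_open Vd dv sd sgap oB) (conj qs Bq))).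
  exact: AB Ar Br.
exists (hat_path_at p s); split.
- exact: tr.
- by rewrite pqs; apply: tr.
- by rewrite hp.
- move=> d2 [Vd2 _ d2d nd2]; rewrite hp; apply: le_lt_trans d's.
  by have := nd' _ Vd2; rewrite d2d andbT -leNgt.
Qed.

(** The values of [h] cluster at a level [s], which has a window inside one band. There the sections
    cluster at a chain, the chain comes from a point of W-hat, and the ultrafilter converges to that
    point. *)
Lemma hatW_compact_slab a b : compact ([set p | a <= hat_h p <= b] : set W).
Proof.
rewrite compact_ultra => F UF Fab.
have hv (p : W) : hat_h p <= h v.
  have := unstable_le LF 0 (hw_ptP (p := p)); rewrite (flow0 LF) => pu.
  exact: le_trans pu (broken_le (hw_pathP p)).
pose G : set_system R := hat_h (v := v) @ F.
have FG : ProperFilter G by exact: fmap_proper_filter.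
have Gab : F (hat_h (v := v) @^-1` `[a, b]%classic).
  by apply: filterS Fab => p pab; rewrite /= in_itv.
have [s [_ Gs]] := segment_compact FG Gab.
have sv : s <= h v.
  rewrite leNgt; apply/negP => vs.
  have Gv : F (hat_h (v := v) @^-1` [set s' | s' <= h v]).
    by apply: filterS filterT => p _; exact: hv.
  have [s' [/= s'v]] := Gs _ _ Gv (lt_nbhsr vs).
  by rewrite ltNge s'v.
have [c [a0 [b0 [[Vc cv] a0s sb0 bandP]]]] := band_window sv.
have [epsc _] := constP Vc cv.
have wle e : crit_value h e -> e <= b0 -> e <= c.
  by apply: (band_le Vc cv); apply: bandP; rewrite lexx andbT; lra.
have wge e : crit_value h e -> a0 <= e -> c <= e.
  by apply: (band_ge Vc cv); apply: bandP; rewrite lexx /=; lra.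
pose K : set W := [set p | a0 <= hat_h p <= b0].
(* An ultrafilter contains [K] or its complement; the complement would keep the values of [h] away
   from [s]. *)
have FK : F K.
  have [//|FnK] := in_ultra_setVsetC K UF.
  have GnK : F (hat_h (v := v) @^-1` [set s' | ~ (a0 <= s' <= b0)]) by [].
  have Ns : nbhs s [set s' | a0 < s' < b0].
    by apply: filterS2 (lt_nbhsr a0s) (lt_nbhsl sb0) => s' /= ? ?; apply/andP.
  have [s' [/= nK /andP[? ?]]] := Gs _ _ GnK Ns.
  by exfalso; apply: nK; apply/andP; split; lra.
pose f := @section _ _ _ h Phi v c (eps c).
pose H : set_system _ := f @ F.
have FH : ProperFilter H by exact: fmap_proper_filter.
have Hch : F (f @^-1` chains Phi (eps c) a0 b0).
  by apply: filterS FK => p pK; exact: (section_chains LF Cv Vc epsc wle wge).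
have [z [chz Hz]] := compact_chains LF epsc wle wge FH Hch.
have [|p0 p0z] := chains_section LF index_drop Cv Vc cv epsc chz.
  by move=> d [_ Vd cd _]; rewrite ltNge; apply/negP => /(wle _ Vd); lra.
have p0K : K p0.
  have [_ _ _ _ [? ? _]] := chz; rewrite /K /= /hat_h /=.
  have -> : hat_i p0 = z.2 by rewrite -p0z.
  by apply/andP.
(* Since [F] contains [K], which lies in the band of [c], an open set needs to be inspected on that
   part alone, where it is the preimage of an open set [D] around the cluster point [z]. *)
have Fp0 : F --> (p0 : W).
  move=> N; rewrite nbhsE => -[A [ oA Ap0] AN]; apply: filterS AN _.
  have [//|FnA] := in_ultra_setVsetC A UF.
  have /open_hatWP/(_ _ Vc cv)[D oD DA] := oA.
  have DP p : K p -> A p <-> D (f p).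
    move=> pK; have pb : @hatW_band _ _ _ h Phi v (del c) c p by exact: bandP.
    have /seteqP[DA1 DA2] := DA.
    by split => [Ap|Dp]; [exact: (DA2 (SigSub (mem_set pb)))|exact: (DA1 (SigSub (mem_set pb)))].
  have Dz : nbhs z D.
    by apply: open_nbhs_nbhs; split => //; rewrite -p0z; apply/DP.
  have HnA : F (f @^-1` (f @` (K `&` ~` A))).
    by apply: filterS (filterI FK FnA) => p pKA; exists p.
  have [_ [[p [pK nAp] <-]]] := Hz _ _ HnA Dz.
  by move=> /(DP _ pK).
exists p0; split => //.
have clab : closed [set s' | a <= s' <= b].
  by rewrite -set_itvcc; exact: itv_closed.
have : closed ([set p | a <= hat_h p <= b] : set W).
  by apply: (@closed_comp _ _ (hat_h (v := v) : W -> R) [set s' | a <= s' <= b]) => // p _;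
    exact: hat_h_continuous.
by move=> cl; apply: (closed_cvg _ cl Fab p0 Fp0).
Qed.

End hatW_space.

(** * Calculus in charts *)

Section C1_differentiable.
Context {R : realType}.

Lemma le_coord_norm n (u : 'rV[R]_n) j : `|u 0 j| <= `|u|.
Proof.
by rewrite [leRHS]mx_normrE (le_bigmax _ (fun ij => `|u ij.1 ij.2|) (0, j)).
Qed.

Lemma le_norm_coord n (u : 'rV[R]_n) c : 0 <= c -> (forall j, `|u 0 j| <= c) -> `|u| <= c.
Proof.
by move=> c0 uc; rewrite [leLHS]mx_normrE; apply: bigmax_le => // -[i j] _; rewrite ord1.
Qed.

Lemma differentiable_eps (V W : normedModType R) (f : V -> W) (L : {linear V -> W}) x :
  continuous L ->
  (forall e, 0 < e -> \forall u \near 0, `|f (u + x) - (f x + L u)| <= e * `|u|) ->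
  differentiable f x.
Proof.
move=> cL fL; suff H : f \o shift x = cst (f x) + L +o_ 0 id.
  by have dE := diff_unique cL H; apply/diff_locallyP; rewrite dE.
exact/eqaddoP.
Qed.

Lemma MVT_direction (V : normedModType R) (f : V -> R^o) (p e : V) (s : R) :
  (forall t, `|t| <= `|s| -> derivable f (p + t *: e) e) ->
  exists2 t, `|t| <= `|s| & f (p + s *: e) - f p = s * 'D_e f (p + t *: e).
Proof.
move=> df; pose g : R -> R := fun t => f (p + t *: e).
have gE (t : R) : (fun k : R => k^-1 *: (g (k *: 1 + t) - g t)) =
    (fun k : R => k^-1 *: (f (k *: e + (p + t *: e)) - f (p + t *: e))).
  apply/funext => k; congr (_ *: (f _ - _)).
  by rewrite /= scalerDl [k *: 1]mulr1 addrCA.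
have dg (t : R) : `|t| <= `|s| ->
    is_derive (t : R^o) (1 : R^o) (g : R^o -> R^o) ('D_e f (p + t *: e)).
  move=> ts; split; first by rewrite /derivable gE; exact: df.
  by rewrite /derive gE.
have g0 : g 0 = f p by rewrite /g scale0r addr0.
have [s0|s0] := leP 0 s.
  have ab t : t \in `[0, s] -> `|t| <= `|s|.
    by rewrite in_itv /= => /andP[t0 ts]; rewrite !ger0_norm.
  have [||t /ab ts gs] := @MVT_segment R g (fun t => 'D_e f (p + t *: e)) 0 s s0.
  - by move=> t /subset_itv_oo_cc/ab; exact: dg.
  - by apply: derivable_within_continuous => t /ab ts; have [] := dg t ts.
  by exists t => //; rewrite -g0 gs subr0 mulrC.
have ab t : t \in `[s, 0] -> `|t| <= `|s|.
  by rewrite in_itv /= => /andP[t0 ts]; rewrite !ler0_norm ?lerN2// ltW.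
have [||t /ab ts gs] := @MVT_segment R g (fun t => 'D_e f (p + t *: e)) s 0 (ltW s0).
- by move=> t /subset_itv_oo_cc/ab; exact: dg.
- by apply: derivable_within_continuous => t /ab ts; have [] := dg t ts.
exists t => //; rewrite -g0 -opprB gs sub0r mulrN opprK mulrC//.
Qed.

(** [Ck] only speaks of directional derivatives, whereas the chain rule needs differentiability. The
    increment is split into coordinate steps, and the mean value theorem is applied to each. *)
Lemma C1_differentiable_real n (f : 'rV[R]_n -> R^o) (U : set 'rV[R]_n) x :
  open U -> U x -> (forall u y, U y -> derivable f y u) ->
  (forall u, {for x, continuous ('D_u f)}) -> differentiable f x.
Proof.
move=> oU Ux df cf.
pose L : 'rV[R]_n -> R^o := fun u => \sum_(j < n) u 0 j * 'D_(delta_mx 0 j) f x.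
have L_lin : linear L.
  move=> a u v; rewrite /L scaler_sumr -big_split /=; apply: eq_bigr => j _.
  by rewrite !mxE mulrDl [_ *: _]mulrA.
pose LM := GRing.isLinear.Build _ _ _ _ L L_lin.
pose LL : {linear 'rV[R]_n -> R^o} := HB.pack L LM.
have cL : continuous LL.
  move=> y; apply: differentiable_continuous.
  have -> : LL = \sum_(j < n) (fun u : 'rV[R]_n => u 0 j *: ('D_(delta_mx 0 j) f x : R^o))
      :> ('rV[R]_n -> R^o).
    by apply/funext => u; rewrite fct_sumE.
  by apply: differentiable_sum => j; apply: differentiableZl; exact: differentiable_coord.
apply: (differentiable_eps cL) => e e0.
(* There are [n] coordinate steps; dividing by [n.+1] also covers [n = 0]. *)
have en0 : 0 < e / n.+1%:R by rewrite divr_gt0.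
have : \forall y \near x, U y /\ forall j : 'I_n,
    `|'D_(delta_mx 0 j) f x - 'D_(delta_mx 0 j) f y| <= e / n.+1%:R.
  apply: filterI; first exact: open_nbhs_nbhs.
  have := @filter_forall _ 'I_n (fun j => [set y | `|'D_(delta_mx 0 j) f x -
    'D_(delta_mx 0 j) f y| <= e / n.+1%:R]) (nbhs x) _.
  apply => j; have /cvgrPdist_le := cf (delta_mx 0 j); exact.
move=> /nbhs_ballP[r /= r0 xr].
apply/nbhs_ballP; exists r => //= u; rewrite -ball_normE /= sub0r normrN => ur.
(* A staircase from [x] to [u + x]: [p k] has its first [k] coordinates already moved. *)
pose p k : 'rV[R]_n := \row_j (x 0 j + (if (j < k)%N then u 0 j else 0)).
have pS (k : 'I_n) : p k.+1 = p k + u 0 k *: delta_mx 0 k.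
  apply/rowP => j; rewrite !mxE eqxx /= -addrA; congr (_ + _).
  rewrite ltnS leq_eqVlt; have [->|jk] := eqVneq j k.
    by rewrite eqxx ltnn add0r mulr1.
  by rewrite -(inj_eq val_inj) /= in jk; rewrite (negPf jk) /= mulr0 addr0.
have pr (k : 'I_n) t : `|t| <= `|u 0 k| -> ball x r (p k + t *: delta_mx 0 k).
  move=> tu; rewrite -ball_normE /=; apply: le_lt_trans ur; apply: le_norm_coord => // j.
  rewrite !mxE eqxx /= opprD opprD addrA addNKr -opprD normrN.
  have [->|jk] := eqVneq j k.
    by rewrite ltnn add0r mulr1; exact: le_trans tu (le_coord_norm _ _).
  by rewrite mulr0 addr0; case: ifP => _; rewrite ?normr0// le_coord_norm.
have step (k : 'I_n) : `|f (p k.+1) - f (p k) - u 0 k * 'D_(delta_mx 0 k) f x| <=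
    `|u| * (e / n.+1%:R).
  rewrite pS; have [t tu|t tu ->] := @MVT_direction _ f (p k) (delta_mx 0 k) (u 0 k).
    by apply: df; case: (xr _ (pr _ _ tu)).
  have [_ /(_ k) xk] := xr _ (pr _ _ tu).
  by rewrite -mulrBr normrM ler_pM ?le_coord_norm// distrC.
have p0 : p 0 = x by apply/rowP => j; rewrite mxE ltn0 addr0.
have pn : p n = u + x by apply/rowP => j; rewrite !mxE ltn_ord addrC.
have -> : f (u + x) - (f x + LL u) =
    \sum_(k < n) (f (p k.+1) - f (p k) - u 0 k * 'D_(delta_mx 0 k) f x).
  rewrite big_split /= sumrN opprD addrA; congr (_ - _).
  rewrite -(big_mkord xpredT (fun k => f (p k.+1) - f (p k))).
  by rewrite (@telescope_sumr _ 0 n (fun k => f (p k)))// p0 pn.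
apply: le_trans (ler_norm_sum _ _ _) _.
apply: le_trans (ler_sum _ (fun k _ => step k)) _.
rewrite sumr_const card_ord -[leLHS]mulr_natr -mulrA mulrC ler_wpM2r//.
rewrite -mulrA ler_piMr ?(ltW e0)//.
by rewrite ler_pdivrMl ?ltr0n// mulr1 ler_nat.
Qed.

Lemma C1_differentiable m n (f : 'rV[R]_n -> 'rV[R]_m) (U : set 'rV[R]_n) x :
  open U -> U x -> Ck 1 U f -> differentiable f x.
Proof.
move=> oU Ux [_ Cf].
have -> : f = \sum_(j < m) (fun y => (f y 0 j) *: delta_mx 0 j).
  by apply/funext => y; rewrite fct_sumE -row_sum_delta.
apply: differentiable_sum => j; apply: differentiableZl.
apply: (C1_differentiable_real oU Ux) => [u y Uy|u].
  by have [/(_ _ Uy)/derivable_mxP] := Cf u; exact.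
have [df [cf _]] := Cf u.
have near_eq : \forall y \near x, 'D_u f y 0 j = 'D_u (fun y => f y 0 j) y.
  apply: filterS (open_nbhs_nbhs (conj oU Ux)) => y Uy.
  by rewrite derive_mx ?mxE//; exact: df.
have c : 'D_u f y 0 j @[y --> x] --> 'D_u f x 0 j.
  exact: (continuous_comp (cf x Ux) (@coord_continuous R 1 m 0 j ('D_u f x))).
have e := nbhs_singleton near_eq; rewrite e in c.
exact: (cvg_trans (near_eq_cvg near_eq) c).
Qed.

Lemma C1_differentiable_fun n (f : 'rV[R]_n -> R^o) (U : set 'rV[R]_n) x :
  open U -> U x -> Ck 1 U f -> differentiable f x.
Proof.
move=> oU Ux [_ Cf]; apply: (C1_differentiable_real oU Ux) => [u y Uy|u].
  by have [/(_ _ Uy)] := Cf u.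
by have [_ [/(_ _ Ux)]] := Cf u.
Qed.

End C1_differentiable.

Lemma is_derive_curve {R : realType} {V W : normedModType R} (f : V -> W) (g : R -> V)
    (t : R) (u : V) :
  is_derive (t : R^o) (1 : R^o) (g : R^o -> V) u -> differentiable f (g t) ->
  is_derive (t : R^o) (1 : R^o) (f \o g : R^o -> W) ('D_u f (g t)).
Proof.
move=> [dg gu] df.
have dg' : differentiable (g : R^o -> V) t by apply/derivable1_diffP.
have dfg : differentiable (f \o g : R^o -> W) t by exact: differentiable_comp.
split; first exact/derivable1_diffP.
by rewrite deriveE// diff_comp//= deriveE// -gu deriveE.
Qed.

Lemma derive_comp {R : realType} {U V W : normedModType R} (f : U -> V) (g : V -> W) a u :
  differentiable f a -> differentiable g (f a) ->
  'D_u (g \o f) a = 'D_('D_u f a) g (f a).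
Proof.
move=> df dg; have dgf := differentiable_comp df dg.
by rewrite (deriveE u dgf) (diff_comp df dg) /= (deriveE u df) (deriveE _ dg).
Qed.

(** Jacobians act on row vectors from the right, so the factor of [f], applied first, stands on the
    left. *)
Lemma jacobian_inverse {R : realType} {n : nat} (f g : 'rV[R]_n -> 'rV[R]_n) a :
  differentiable f a -> differentiable g (f a) -> (\forall x \near a, g (f x) = x) ->
  jacobian f a *m jacobian g (f a) = 1%:M.
Proof.
move=> df dg gf; apply/row_matrixP => i; rewrite !rowE mulmx1 mulmxA.
rewrite -(deriveEjacobian _ df) -(deriveEjacobian _ dg) -(derive_comp _ df dg).
by rewrite (near_eq_derive (g := id) _ gf) derive_id.
Qed.

Section charts.
Context {R : realType} {n : nat} {M : manifold R n}.
Implicit Types (c d : chart R n M).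

Lemma chart_near c x : is_chart c -> cdom c x -> \forall z \near x, cdom c z.
Proof. by move=> [[oc _] _ _ _ _] cx; exact: open_nbhs_nbhs. Qed.

Lemma chart_nbhs c x (A : set M) : is_chart c -> cdom c x -> nbhs x A ->
  \forall y \near cfun c x, ccod c y /\ A (cinv c y).
Proof.
move=> [[oc occ] cf ci ccf cci] cx xA; have [yc xE] := cf _ cx.
apply: filterI; first exact: open_nbhs_nbhs.
by apply: (cci _ yc); rewrite xE.
Qed.

Lemma chart_open c (A : set M) : is_chart c -> open A ->
  open [set y | ccod c y /\ A (cinv c y)].
Proof.
move=> cc oA; have [_ _ ci _ _] := cc; rewrite openE => y [cy Ay].
have [cy' yE] := ci _ cy; rewrite /interior -yE; apply: chart_nbhs => //.
exact: open_nbhs_nbhs.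
Qed.

Lemma transition_differentiable c d x : is_chart c -> is_chart d ->
  smooth_transition c d -> cdom c x -> cdom d x ->
  differentiable (cfun d \o cinv c) (cfun c x).
Proof.
move=> cc cd sm cx dx; have [_ /(_ _ cx)[yc xE] _ _ _] := cc.
apply: (C1_differentiable _ _ (sm 1)) => /=; last by rewrite xE.
by apply: chart_open => //; have [[]] := cd.
Qed.

End charts.

(** * The flow in coordinates *)

Section flow_calculus.
Context {R : realType} {n : nat} {M : manifold R n}.
Variables (X : M -> 'rV[R]_n) (Phi : R -> M -> M).
Hypothesis flowP : is_flow X Phi.

Let phic : continuous (fun z : R * M => Phi z.1 z.2). Proof. by case: flowP. Qed.

Lemma is_flow_continuous_time x : continuous (Phi ^~ x).
Proof. exact: continuous_time phic. Qed.

Lemma is_flow_continuous_space t : continuous (Phi t).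
Proof. exact: continuous_space phic. Qed.

(** [is_flow] gives the velocity only in the atlas chart attached to the point reached; the
    transition map carries it to [c]. *)
Lemma flow_chart_derive (c : chart R n M) t x : is_chart c ->
  (forall p, compatible c (chart_at p)) -> cdom c (Phi t x) ->
  is_derive (t : R^o) (1 : R^o) (fun s : R^o => cfun c (Phi s x))
    (coord_vec c (Phi t x) (X (Phi t x))).
Proof.
move=> cc comp cx; have [_ _ _ _ dPhi] := flowP.
set q := chart_at (Phi t x).
have cq : is_chart q by exact: chart_atP.
have qx : cdom q (Phi t x) by exact: chart_at_dom.
have tr : differentiable (cfun c \o cinv q) (cfun q (Phi t x)).
  by apply: transition_differentiable => //; have [] := comp (Phi t x).
have D := is_derive_curve (g := fun s => cfun q (Phi s x)) (dPhi t x) tr.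
apply: near_eq_is_derive D.
have N : \forall s \near t, cdom q (Phi s x).
  exact: (is_flow_continuous_time (x := x) (chart_near cq qx)).
by apply: filterS N => s qs /=; have [_ /(_ _ qs)[_ ->]] := cq.
Qed.

Lemma flow_fun_derive (h : M -> R) t x : smooth_function h ->
  is_derive (t : R^o) (1 : R^o) (fun s : R^o => h (Phi s x) : R^o)
    (dfun h (Phi t x) (X (Phi t x))).
Proof.
move=> sh; have [_ _ _ _ dPhi] := flowP.
set q := chart_at (Phi t x).
have cq : is_chart q by exact: chart_atP.
have qx : cdom q (Phi t x) by exact: chart_at_dom.
have [[_ oq] /(_ _ qx)[yq xE] _ _ _] := cq.
have hq : differentiable (h \o cinv q : _ -> R^o) (cfun q (Phi t x)).
  exact: (C1_differentiable_fun oq yq (sh (Phi t x) 1)).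
have D := is_derive_curve (g := fun s => cfun q (Phi s x)) (dPhi t x) hq.
apply: near_eq_is_derive D.
have N : \forall s \near t, cdom q (Phi s x).
  exact: (is_flow_continuous_time (x := x) (chart_near cq qx)).
by apply: filterS N => s qs /=; have [_ /(_ _ qs)[_ ->]] := cq.
Qed.

Lemma smooth_function_continuous (h : M -> R) : smooth_function h -> continuous h.
Proof.
move=> sh x; set q := chart_at x.
have cq : is_chart q by exact: chart_atP.
have qx : cdom q x by exact: chart_at_dom.
have [[_ oq] qf _ cf _] := cq; have [yq xE] := qf _ qx.
have [ch _] := sh x 0.
have c := continuous_comp (cf _ qx) (ch _ yq).
have e : \forall z \near x, (h \o cinv q \o cfun q) z = h z.
  by apply: filterS (chart_near cq qx) => z /qf[_ /= ->].
have e0 := nbhs_singleton e; rewrite /continuous_at /= in c *.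
rewrite -[in X in _ --> X]e0; apply: cvg_trans c; apply: near_eq_cvg.
by apply: filterS e => z <-.
Qed.

(** Joint smoothness in time and space is restricted to a fixed time: directional derivatives along
    [u] are those along [(0, u)]. *)
Lemma flow_chart_differentiable p q t x : cdom (chart_at p) x -> cdom (chart_at q) (Phi t x) ->
  differentiable (fun y => cfun (chart_at q) (Phi t (cinv (chart_at p) y)))
    (cfun (chart_at p) x).
Proof.
move=> px qx; have cp := chart_atP p; have cq := chart_atP q.
have [_ pf _ _ _] := cp; have [yp xE] := pf _ px.
pose O := [set z : R^o * 'rV[R]_n | ccod (chart_at p) z.2 /\
  cdom (chart_at q) (Phi z.1 (cinv (chart_at p) z.2))].
pose F (z : R^o * 'rV[R]_n) := cfun (chart_at q) (Phi z.1 (cinv (chart_at p) z.2)).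
have [cF dF] : Ck 1 O F by have [_ _ _ /(_ p q 1) H _] := flowP.
pose U : set 'rV[R]_n := [set y | ccod (chart_at p) y /\
  cdom (chart_at q) (Phi t (cinv (chart_at p) y))].
have oU : open U.
  have oA : open (Phi t @^-1` cdom (chart_at q)).
    apply: open_comp; first by move=> z _; exact: is_flow_continuous_space.
    by have [[]] := cq.
  exact: (chart_open cp oA).
apply: (C1_differentiable oU); first by split => //=; rewrite xE.
have OU y : U y -> O (t, y) by [].
have ct : continuous (fun y : 'rV[R]_n => (t : R^o, y)).
  have c1 : continuous (fun _ : 'rV[R]_n => t : R^o) by exact: cst_continuous.
  by apply: (continuous_pair c1) => ?; exact: cvg_id.
have quot (u y : 'rV[R]_n) : (fun k : R => k^-1 *: ((F \o shift (t : R^o, y))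
      (k *: (0 : R^o, u)) - F (t : R^o, y))) =
    (fun k : R => k^-1 *: (((fun y => F (t : R^o, y)) \o shift y) (k *: u) - F (t : R^o, y))).
  by apply/funext => k; congr (_ *: (F _ - _)); congr pair => /=; rewrite scaler0 add0r.
split.
  by move=> y /OU/cF c; exact: (continuous_comp (ct y) c).
move=> u; have [dFu [cFu _]] := dF (0, u).
have DE y : 'D_u (fun y => F (t, y)) y = 'D_((0 : R^o), u) F (t, y).
  by rewrite /derive quot.
split.
  by move=> y /OU /dFu; rewrite /derivable quot.
split => //.
have -> : 'D_u (fun y => F (t : R^o, y)) = (fun y => 'D_((0 : R^o), u) F (t : R^o, y)).
  exact/funext.
by move=> y Uy; exact: (continuous_comp (ct y) (cFu _ (OU _ Uy))).
Qed.

End flow_calculus.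

(** * The local model at a critical point *)

Section local_model.
Context {R : realType} {n : nat} {M : manifold R n}.
Variables (h : M -> R) (X : M -> 'rV[R]_n) (Phi : R -> M -> M).
Hypothesis flowP : is_flow X Phi.
Hypothesis hS : smooth_function h.
Variables (v : M) (r : R) (c : chart R n M).
Local Notation ind := (morse_index h v).
Hypothesis r0 : 0 < r.
Hypothesis ccodE : ccod c = eball r.
Hypothesis cC : is_chart c.
Hypothesis c_compat : forall p, compatible c (chart_at p).
Hypothesis cv : cdom c v.
Hypothesis h_model : forall y, eball r y -> h (cinv c y) = h v
  - 2^-1 * (\sum_(j < n | (j < ind)%N) y 0 j ^+ 2)
  + 2^-1 * (\sum_(j < n | (ind <= j)%N) y 0 j ^+ 2).
Hypothesis X_model : forall y, eball r y -> coord_vec c (cinv c y) (X (cinv c y)) =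
  \row_j (if (j < ind)%N then y 0 j else - y 0 j).

(** The eigenvalue of the linear model of [X] in direction [j]. *)
Definition model_sign (j : 'I_n) : R := if (j < ind)%N then 1 else -1.

Lemma chart_eball x : cdom c x -> eball r (cfun c x) /\ cinv c (cfun c x) = x.
Proof. by have [_ + _ _ _] := cC => /[apply]; rewrite ccodE. Qed.

Lemma coord_lt x j : cdom c x -> `|cfun c x 0 j| < r.
Proof.
move=> /chart_eball[yr _]; rewrite -ltr_sqr ?nnegrE ?(ltW r0)// real_normK ?num_real//.
apply: le_lt_trans yr; rewrite (bigD1 j)//= lerDl sumr_ge0// => i _.
exact: sqr_ge0.
Qed.

Lemma coord_derive t x j : cdom c (Phi t x) ->
  is_derive (t : R^o) (1 : R^o) (fun s : R^o => cfun c (Phi s x) 0 j : R^o)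
    (model_sign j * cfun c (Phi t x) 0 j).
Proof.
move=> cx; have [dc De] := flow_chart_derive flowP cC c_compat cx.
have [yr yE] := chart_eball cx.
have := X_model yr; rewrite yE => fE; rewrite fE in De.
split; first by move/derivable_mxP : dc; exact.
have := congr1 (fun z : 'rV[R]_n => z 0 j) De; rewrite derive_mx// !mxE => ->.
by rewrite /model_sign; case: ifP => _; rewrite ?mul1r ?mulN1r.
Qed.

(** Inside the chart each coordinate solves [y' = model_sign j * y], so its product with the inverse
    exponential has zero derivative. *)
Lemma coord_exp a b x j : a <= b -> (forall s, a <= s <= b -> cdom c (Phi s x)) ->
  cfun c (Phi b x) 0 j * expR (- (model_sign j * b)) =
  cfun c (Phi a x) 0 j * expR (- (model_sign j * a)).
Proof.
move=> ab cx; pose k := model_sign j.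
pose g : R^o -> R^o := fun s => cfun c (Phi s x) 0 j * expR (- (k * s)).
have dg s : a <= s <= b -> is_derive (s : R^o) (1 : R^o) g 0.
  move=> /cx/(@coord_derive s x j) D1.
  have D2 : is_derive (s : R^o) (1 : R^o) (fun s : R^o => expR (- (k * s)) : R^o)
      (- k * expR (- (k * s))).
    have D2 : is_derive (s : R^o) (1 : R^o) (fun s : R^o => - (k * s) : R^o) (- k).
      apply: is_derive_eq (is_deriveN (is_deriveZ k (is_derive_id (s : R^o) (1 : R^o)))) _.
      by rewrite [k *: _]mulr1.
    have D := @is_derive1_comp R expR (fun s => - (k * s)) s _ _ (is_derive_expR (- (k * s))) D2.
    exact: (is_derive_eq D (mulrC _ _)).
  have D3 : is_derive (s : R^o) (1 : R^o) g _ := is_deriveM D1 D2.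
  apply: is_derive_eq D3 _.
  rewrite /GRing.scale /= -/k; ring.
have [||z _ gz] := @MVT_segment R g (fun=> 0) a b ab.
- by move=> s; rewrite in_itv /= => /andP[/ltW ? /ltW ?]; apply: dg; apply/andP.
- apply: derivable_within_continuous => s; rewrite in_itv /= => sab.
  by have [] := dg s sab.
by apply/eqP; rewrite -subr_eq0 -[X in X == 0]/(g b - g a) gz mul0r.
Qed.

(** The derivative of [h] along the flow is computed twice: it vanishes at a critical point, and the
    quadratic model gives minus the sum of the squared coordinates. *)
Lemma crit_center x : cdom c x -> Crit h x -> cfun c x = 0.
Proof.
move=> cx Cx; have [Phi0 _ _ _ _] := flowP.
have cx0 : cdom c (Phi 0 x) by rewrite Phi0.
have [_ D1] := flow_fun_derive flowP 0 x hS; rewrite Phi0 Cx in D1.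
pose k (j : 'I_n) : R := - (2^-1 * model_sign j).
have hE y : eball r y -> h (cinv c y) = h v + \sum_(j < n) k j * y 0 j ^+ 2.
  move=> yr; rewrite (h_model yr) -addrA; congr (_ + _).
  rewrite [RHS](bigID (fun j : 'I_n => (j < ind)%N)) /= -mulrN -sumrN !mulr_sumr.
  congr (_ + _); first by apply: eq_bigr => j jm; rewrite /k /model_sign jm; lra.
  apply: eq_big => [j|j]; first by rewrite leqNgt.
  by rewrite leqNgt /k /model_sign => /negPf ->; lra.
have D2 : is_derive (0 : R^o) (1 : R^o)
    (\sum_(j < n) (fun s : R^o => k j * cfun c (Phi s x) 0 j ^+ 2 : R^o))
    (\sum_(j < n) - (cfun c x 0 j ^+ 2)).
  apply: is_derive_sum => j.
  have D := coord_derive j cx0.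
  apply: is_derive_eq (is_deriveZ (k j : R) (is_deriveX 2 D)) _.
  rewrite /GRing.scale /= Phi0 /k expr1 expr2; move: (cfun c x 0 j) => z.
  by rewrite /model_sign; case: ifP => _; rewrite -mulr_natl; lra.
have [_ D3] := is_deriveD (is_derive_cst (h v : R^o) (0 : R^o) (1 : R^o)) D2.
have N : \forall s \near (0 : R), cdom c (Phi s x).
  exact: (is_flow_continuous_time flowP (x := x) (chart_near cC cx0)).
have : 'D_(1 : R^o) (fun s : R^o => h (Phi s x) : R^o) (0 : R^o) =
    \sum_(j < n) - (cfun c x 0 j ^+ 2).
  rewrite -[RHS]add0r -D3; apply: near_eq_derive; apply: filterS N => s /chart_eball[yr yE].
  by rewrite -[in LHS]yE (hE _ yr) /= fctE /= fct_sumE.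
rewrite D1 sumrN => /esym/eqP; rewrite oppr_eq0 psumr_eq0; last by move=> j _; exact: sqr_ge0.
move=> /allP H; apply/rowP => j; rewrite mxE; apply/eqP.
by rewrite -sqrf_eq0; apply: H; rewrite mem_index_enum.
Qed.

Lemma chart_inj x y : cdom c x -> cdom c y -> cfun c x = cfun c y -> x = y.
Proof.
by move=> /chart_eball[_ xE] /chart_eball[_ yE] e; rewrite -xE e yE.
Qed.

Lemma local_crit_unique x : Crit h v -> cdom c x -> Crit h x -> x = v.
Proof. by move=> Cv cx Cx; apply: chart_inj; rewrite // !crit_center. Qed.

(** By [coord_exp] the coordinates remain zero as long as the orbit stays in the chart. A longer
    time is divided into [m] equal steps shorter than [e], and the group law covers negative
    times. *)
Lemma crit_fixed t : Crit h v -> Phi t v = v.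
Proof.
move=> Cv; have [Phi0 PhiD _ _ _] := flowP.
have [e /= e0 eP] : \forall s \near (0 : R), cdom c (Phi s v).
  apply: (is_flow_continuous_time flowP (x := v) (x0 := 0)).
  by apply: chart_near => //; rewrite Phi0.
have small s : 0 <= s < e -> Phi s v = v.
  move=> /andP[s0 se].
  have cs s' : 0 <= s' <= s -> cdom c (Phi s' v).
    move=> /andP[s'0 s's]; apply: eP; rewrite /ball_ /= sub0r normrN ger0_norm//.
    exact: le_lt_trans s's se.
  apply: chart_inj => //; first by apply: cs; rewrite s0 lexx.
  apply/rowP => j; rewrite (crit_center cv Cv) [RHS]mxE.
  have := coord_exp j s0 cs; rewrite Phi0 (crit_center cv Cv) [X in _ = X * _]mxE mul0r.
  by move/eqP; rewrite mulf_eq0 (gt_eqF (expR_gt0 _)) orbF => /eqP ->.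
have mult s m : Phi s v = v -> Phi (m%:R * s) v = v.
  move=> sv; elim: m => [|m IH]; first by rewrite mul0r Phi0.
  by rewrite -natr1 mulrDl mul1r PhiD sv.
have pos s : 0 <= s -> Phi s v = v.
  move=> s0; have := archi_boundP (divr_ge0 s0 (ltW e0)).
  set m := Num.bound _ => sm.
  have m0 : 0 < m%:R :> R by apply: le_lt_trans sm; rewrite divr_ge0// ltW.
  have mn0 : m%:R != 0 :> R by rewrite gt_eqF.
  rewrite -(mulVKf mn0 s); apply: mult; apply: small.
  apply/andP; split; first by rewrite mulr_ge0// invr_ge0 ltW.
  by rewrite ltr_pdivrMl// -ltr_pdivrMr.
have [/pos//|t0] := leP 0 t.
rewrite -[in LHS](pos (- t)) ?oppr_ge0 ?ltW// -PhiD subrr Phi0//.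
Qed.

End local_model.

(** * From a Morse-Smale pair to a flow with a Lyapunov function *)

Section morse_smale_lyapunov.
Context {R : realType} {n : nat} {M : manifold R n}.
Variables (h : M -> R) (X : M -> 'rV[R]_n) (Phi : R -> M -> M).
Hypotheses (flowP : is_flow X Phi) (msP : morse_smale h X Phi).

Lemma morse_smale_lyapunov : lyapunov_flow h Phi (Crit h).
Proof.
have [[hS _] hproper [_ h_decr h_model] _] := msP.
have [Phi0 PhiD Phic _ _] := flowP.
have fixed t x : Crit h x -> Phi t x = x.
  move=> Cx; have [r [c [[r0 cE] [cC cc] cx hm Xm]]] := h_model x Cx.
  exact: (crit_fixed flowP hS cE cC cc cx hm Xm).
have hc := smooth_function_continuous hS.
split => //.
- exact: mhausdorff.
- move=> a b; have -> : [set x | a <= h x <= b] = h @^-1` `[a, b]%classic.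
    by apply/seteqP; split => x /=; rewrite in_itv.
  by apply: hproper; exact: segment_compact.
- move=> t x Cx t0; rewrite -[X in _ < h X]Phi0.
  have D s := flow_fun_derive flowP s x hS.
  have Cs s : ~ Crit h (Phi s x).
    by move=> Cs; apply: Cx; move: (Cs); rewrite -(fixed (- s) _ Cs) -PhiD addNr Phi0.
  apply: (@ltr0_derive1_decr R (fun s => h (Phi s x)) 0 t); rewrite ?lexx //.
  + move=> s _; rewrite derive1E; have [_ E] := D s.
    by rewrite [X in X < _]E; exact/h_decr/Cs.
  + by apply: derivable_within_continuous => s _; have [d _] := D s; exact: d.
- move=> u Cu; have [r [c [[r0 cE] [cC cc] cu hm Xm]]] := h_model u Cu.
  apply: filterS (chart_near cC cu) => x cx Cx.
  exact: (local_crit_unique flowP hS cE cC cc cu hm Xm).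
Qed.

End morse_smale_lyapunov.

(** * Transversality and the index *)

(** The two kernels have dimensions [i] and [n - j], span the whole space and share the nonzero
    vector [u], so [n + 1 <= i + (n - j)]. They will contain the tangent vectors to the unstable and
    the stable set, and [u] will be the field. *)
Lemma kernel_sum_rank {F : fieldType} {n : nat} (A B : 'M[F]_n) (i j : nat) (u : 'rV[F]_n) :
  A \in unitmx -> B \in unitmx -> (i <= n)%N -> (j <= n)%N -> u != 0 ->
  u *m A *m copid_mx i = 0 -> u *m B *m pid_mx j = 0 :> 'rV[F]_n ->
  (forall w : 'rV[F]_n, exists a b, [/\ a *m A *m copid_mx i = 0,
     b *m B *m pid_mx j = 0 :> 'rV[F]_n & w = a + b]) -> (j < i)%N.
Proof.
move=> Au Bu iN jN u0 uA uB span.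
pose K := kermx (A *m copid_mx i); pose L := kermx (B *m (pid_mx j : 'M[F]_n)).
have rK : \rank K = i.
  rewrite mxrank_ker (eqmxMfull _ _) ?row_full_unit// rank_copid_mx// subKn//.
have rL : \rank L = (n - j)%N.
  rewrite mxrank_ker (eqmxMfull _ _) ?row_full_unit// rank_pid_mx//.
have uKL : (u <= K :&: L)%MS.
  by rewrite sub_capmx; apply/andP; split; apply/sub_kermxP; rewrite mulmxA.
have cap : (0 < \rank (K :&: L))%N.
  apply: leq_trans (mxrankS uKL); rewrite lt0n mxrank_eq0//.
have full : \rank (K + L)%MS = n.
  apply/eqP; rewrite -[_ == n]/(row_full _) -sub1mx; apply/row_subP => k.
  have [a [b [aK bL ->]]] := span (row k 1%:M).
  by apply: addmx_sub_adds; apply/sub_kermxP; rewrite mulmxA.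
have := mxrank_sum_cap K L; rewrite full rK rL; lia.
Qed.

Section local_manifolds.
Context {R : realType} {n : nat} {M : manifold R n}.
Variables (h : M -> R) (X : M -> 'rV[R]_n) (Phi : R -> M -> M).
Hypotheses (flowP : is_flow X Phi) (msP : morse_smale h X Phi).
Let LF := morse_smale_lyapunov flowP msP.
Let LFr := lyapunov_flow_rev LF.

Definition good_chart (c : chart R n M) := is_chart c /\ forall p, compatible c (chart_at p).

Lemma local_stable w : Crit h w -> exists (c : chart R n M) (V : set M),
  [/\ good_chart c, nbhs w V, V `<=` cdom c & forall z (j : 'I_n), V z -> stable Phi w z ->
    (j < morse_index h w)%N -> cfun c z 0 j = 0].
Proof.
have [[hS _] hproper [_ h_decr h_model] _] := msP.
move=> Cw; have [r [c [[r0 cE] [cC cc] cw hm Xm]]] := h_model w Cw.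
have wc := chart_near cC cw.
have [V [e [wV e0 Ve]]] := crit_exit LF Cw wc.
exists c, (V `&` cdom c); split; [by []|exact: filterI|by move=> z []|].
move=> z j [Vz cz] zw jw; apply/eqP/negPn/negP => y0.
have stay t : 0 <= t -> cdom c (Phi t z).
  move=> t0; apply: contrapT => nc; have := Ve z t Vz t0 nc.
  by have := stable_ge LF t zw; lra.
(* Long enough, since [expR t >= 1 + t > t] makes the coordinate at least [r] in absolute value. *)
pose t := r / `|cfun c z 0 j|.
have t0 : 0 <= t by rewrite divr_ge0// ltW.
have := coord_exp flowP cE cC cc Xm (a := 0) (b := t) (x := z) j t0.
rewrite (flow0 LF) /model_sign jw mulr0 oppr0 expR0 mulr1 mul1r => H.
have {}H : cfun c (Phi t z) 0 j * expR (- t) = cfun c z 0 j.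
  by apply: H => s /andP[s0 _]; exact: stay.
have := coord_lt r0 cE cC j (stay t t0); rewrite ltNge => /negP; apply.
have -> : cfun c (Phi t z) 0 j = cfun c z 0 j * expR t.
  by rewrite -H -mulrA -expRD addNr expR0 mulr1.
rewrite normrM [`|expR t|]ger0_norm ?expR_ge0// mulrC -ler_pdivrMr ?normr_gt0//.
by apply: le_trans (expR_ge1Dx t); rewrite -/t; lra.
Qed.

(** Mirror image of [local_stable]: in backward time it is the contracting coordinates that grow. *)
Lemma local_unstable v : Crit h v -> exists (c : chart R n M) (V : set M),
  [/\ good_chart c, nbhs v V, V `<=` cdom c & forall z (j : 'I_n), V z -> unstable Phi v z ->
    (morse_index h v <= j)%N -> cfun c z 0 j = 0].
Proof.
have [[hS _] hproper [_ h_decr h_model] _] := msP.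
move=> Cw; have [r [c [[r0 cE] [cC cc] cw hm Xm]]] := h_model v Cw.
have wc := chart_near cC cw.
have [V [e [wV e0 Ve]]] := crit_exit LFr Cw wc.
exists c, (V `&` cdom c); split; [by []|exact: filterI|by move=> z []|].
move=> z j [Vz cz] zw jw; apply/eqP/negPn/negP => y0.
have stay t : 0 <= t -> cdom c (Phi (- t) z).
  move=> t0; apply: contrapT => nc; have := Ve z t Vz t0 nc.
  by have := unstable_le LF (- t) zw; lra.
pose t := r / `|cfun c z 0 j|.
have t0 : 0 <= t by rewrite divr_ge0// ltW.
have nt0 : - t <= 0 by rewrite oppr_le0.
have := coord_exp flowP cE cC cc Xm (a := - t) (b := 0) (x := z) j nt0.
rewrite (flow0 LF) /model_sign ltnNge jw /= mulr0 oppr0 expR0 mulr1 mulN1r opprK => H.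
have {}H : cfun c z 0 j = cfun c (Phi (- t) z) 0 j * expR (- t).
  by apply: H => s /andP[s0 s1]; rewrite -[s]opprK; apply: stay; rewrite oppr_ge0.
have := coord_lt r0 cE cC j (stay t t0); rewrite ltNge => /negP; apply.
have -> : cfun c (Phi (- t) z) 0 j = cfun c z 0 j * expR t.
  by rewrite H -mulrA -expRD addNr expR0 mulr1.
rewrite normrM [`|expR t|]ger0_norm ?expR_ge0// mulrC -ler_pdivrMr ?normr_gt0//.
by apply: le_trans (expR_ge1Dx t); rewrite -/t; lra.
Qed.

(** Along a curve on which the [j]-th coordinate of [F] vanishes, the chain rule makes the velocity
    satisfy a linear equation. It serves both for tangent vectors and for the field itself. *)
Lemma velocity_vanish (g : R -> M) (x : M) (u : 'rV[R]_n) (F : M -> 'rV[R]_n) (j : 'I_n) :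
  g 0 = x ->
  is_derive (0 : R^o) (1 : R^o) (fun s : R^o => cfun (chart_at x) (g s)) u ->
  differentiable (F \o cinv (chart_at x)) (cfun (chart_at x) x) ->
  (\forall s \near (0 : R), cdom (chart_at x) (g s) /\ F (g s) 0 j = 0) ->
  (u *m jacobian (F \o cinv (chart_at x)) (cfun (chart_at x) x)) 0 j = 0.
Proof.
move=> g0; have := chart_atP x; move: (chart_at x) => q [_ cf _ _ _]; rewrite -g0.
move=> Dg dF N; rewrite -(deriveEjacobian _ dF); have [dc E] := is_derive_curve Dg dF.
have {}E : 'D_(1 : R^o) (fun s : R^o => F (cinv q (cfun q (g s)))) (0 : R^o) =
  'D_u (F \o cinv q) (cfun q (g 0)) := E.
rewrite -E derive_mx// mxE (near_eq_derive (g := cst (0 : R^o))) ?derive_cst//.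
by apply: filterS N => s [/cf[_ sE] F0] /=; rewrite sE.
Qed.

Lemma tangent_vanish (S N : set M) (x : M) (u : 'rV[R]_n) (F : M -> 'rV[R]_n) (j : 'I_n) :
  tangent S x u -> nbhs x N ->
  differentiable (F \o cinv (chart_at x)) (cfun (chart_at x) x) ->
  (forall m, N m -> S m -> F m 0 j = 0) ->
  (u *m jacobian (F \o cinv (chart_at x)) (cfun (chart_at x) x)) 0 j = 0.
Proof.
move=> [e [g /= [e0 g0 gS sm gu]]] xN dF NF.
have cq := chart_atP x; have qx := chart_at_dom x; have [_ cf _ _ _] := cq.
have small0 : `|0 : R| < e by rewrite normr0.
have [cg' /(_ (1 : R^o))[dg' _]] := sm 1.
apply: (velocity_vanish g0) => //.
  by split; [exact: dg'|].
have N1 := chart_nbhs cq qx xN.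
have N2 : \forall s \near (0 : R), N (cinv (chart_at x) (cfun (chart_at x) (g s))).
  have N3 : \forall y \near cfun (chart_at x) (g 0), N (cinv (chart_at x) y).
    by rewrite g0; apply: filterS N1 => y [].
  exact: (cg' 0 small0 _ N3).
have N4 : \forall s \near (0 : R), `|s| < e.
  by exists e => //= s; rewrite /ball_ /= sub0r normrN.
apply: filterS2 N2 N4 => s Ns /gS[Ss qs]; split => //.
by apply: NF => //; have [_ sE] := cf _ qs; rewrite -sE.
Qed.

Lemma field_vanish (S N : set M) (x : M) (F : M -> 'rV[R]_n) (j : 'I_n) :
  (forall t, S (Phi t x)) -> nbhs x N ->
  differentiable (F \o cinv (chart_at x)) (cfun (chart_at x) x) ->
  (forall m, N m -> S m -> F m 0 j = 0) ->
  (X x *m jacobian (F \o cinv (chart_at x)) (cfun (chart_at x) x)) 0 j = 0.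
Proof.
move=> Sx xN dF NF; have [_ _ _ _ D] := flowP.
have cq := chart_atP x; have qx := chart_at_dom x.
have D0 := D 0 x; rewrite (flow0 LF) in D0.
apply: (velocity_vanish (flow0 LF x) D0) => //.
have xNq : nbhs (Phi 0 x) (N `&` cdom (chart_at x)).
  by rewrite (flow0 LF); exact: filterI xN (chart_near cq qx).
have H : \forall s \near (0 : R), N (Phi s x) /\ cdom (chart_at x) (Phi s x).
  exact: (is_flow_continuous_time flowP xNq).
by apply: filterS H => s [Ns qs]; split => //; exact: NF.
Qed.

Lemma mulmx_copid_eq0 (y : 'rV[R]_n) i :
  (forall k : 'I_n, (i <= k)%N -> y 0 k = 0) -> y *m copid_mx i = 0.
Proof.
move=> y0; apply/rowP => l; rewrite !mxE big1// => k _.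
have [/y0 ->|ki] := leqP i k; first by rewrite mul0r.
by rewrite !mxE ki andbT -val_eqE subrr mulr0.
Qed.

Lemma mulmx_pid_eq0 (y : 'rV[R]_n) i :
  (forall k : 'I_n, (k < i)%N -> y 0 k = 0) -> y *m pid_mx i = 0 :> 'rV[R]_n.
Proof.
move=> y0; apply/rowP => l; rewrite !mxE big1// => k _.
by rewrite !mxE; case: ltnP => [/y0 ->|_]; rewrite ?mul0r// andbF mulr0.
Qed.

Lemma morse_index_le v : (morse_index h v <= n)%N.
Proof. by apply/bigmax_leqP => k _; rewrite -ltnS. Qed.

(** All conditions are written in the chart at [x]. That [X x] is nonzero and lies in both kernels
    makes the inequality strict. *)
Lemma index_drop v w x : Crit h v -> Crit h w -> v <> w ->
  unstable Phi v x -> stable Phi w x -> (morse_index h w < morse_index h v)%N.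
Proof.
move=> Cv Cw vw.
(* Moving [x] backwards along its orbit brings it into the chart at [v], where the unstable set
   satisfies its linear equations. *)
wlog : x / exists V : set M, nbhs x V /\ exists c : chart R n M, [/\ good_chart c, V `<=` cdom c &
    forall z (j : 'I_n), V z -> unstable Phi v z -> (morse_index h v <= j)%N -> cfun c z 0 j = 0].
  move=> H vx xw; have [c [V [gc vV Vc Vz]]] := local_unstable Cv.
  have NV : \forall t \near -oo, nbhs (Phi t x) V by exact: (vx _ (nbhs_interior vV)).
  have [S xS] := filter_ex NV.
  apply: (H (Phi S x)).
  - by exists V; split => //; exists c.
  - exact: (unstable_flow LF _ vx).
  - exact: (stable_flow LF _ xw).
move=> [V1 [xV1 [cv [[cvC cvc] V1c V1z]]]] vx xw.
have [cw [V2 [[cwC cwc] wV2 V2c V2z]]] := local_stable Cw.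
have NV2 : \forall t \near +oo, nbhs (Phi t x) V2 by exact: (xw _ (nbhs_interior wV2)).
have [T xT] := filter_ex NV2.
have [[hS _] _ [_ h_decr _] transv] := msP.
have Cx : ~ Crit h x.
  by move=> Cx; apply: vw; rewrite -(unstable_crit_eq LF Cx vx) -(stable_crit_eq LF Cx xw).
pose z := Phi T x; pose q := chart_at x; pose p := chart_at z.
have qC : is_chart q by exact: chart_atP.
have pC : is_chart p by exact: chart_atP.
have qx : cdom q x by exact: chart_at_dom.
have pz : cdom p z by exact: chart_at_dom.
have cvx : cdom cv x by apply: V1c; exact: nbhs_singleton.
have cwz : cdom cw z by apply: V2c; exact: nbhs_singleton.
have qf m : cdom q m -> cinv q (cfun q m) = m by have [_ H _ _ _] := qC; move=> /H[].
have qi y : ccod q y -> cfun q (cinv q y) = y by have [_ _ H _ _] := qC; move=> /H[].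
have pf m : cdom p m -> cinv p (cfun p m) = m by have [_ H _ _ _] := pC; move=> /H[].
have cvf m : cdom cv m -> cinv cv (cfun cv m) = m by have [_ H _ _ _] := cvC; move=> /H[].
have cwf m : cdom cw m -> cinv cw (cfun cw m) = m by have [_ H _ _ _] := cwC; move=> /H[].
pose A := jacobian (cfun cv \o cinv q) (cfun q x).
have dA : differentiable (cfun cv \o cinv q) (cfun q x).
  by apply: transition_differentiable => //; have [] := cvc x.
have Au : A \in unitmx.
  suff /mulmx1_unit[Au _] : A *m
      jacobian (cfun q \o cinv cv) ((cfun cv \o cinv q) (cfun q x)) = 1%:M.
    exact: Au.
  apply: jacobian_inverse => //=.
    by rewrite /= (qf _ qx); apply: transition_differentiable => //; have [] := cvc x.
  apply: filterS (chart_nbhs qC qx (chart_near cvC cvx)) => y [yq yc].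
  by rewrite cvf// qi.
pose F m := cfun cw (cinv p (cfun p (Phi T m))).
pose B := jacobian (F \o cinv q) (cfun q x).
have dB1 : differentiable (fun y => cfun p (Phi T (cinv q y))) (cfun q x).
  exact: (flow_chart_differentiable flowP).
have dB : differentiable (F \o cinv q) (cfun q x).
  have dc : differentiable (cfun cw \o cinv p) (cfun p (Phi T (cinv q (cfun q x)))).
    by rewrite (qf _ qx); apply: transition_differentiable => //; have [] := cwc z.
  exact: (differentiable_comp dB1 dc).
have near_pw : \forall m \near x, cdom p (Phi T m) /\ cdom cw (Phi T m).
  have N : nbhs (Phi T x) (cdom p `&` cdom cw).
    by apply: filterI; exact: chart_near.
  exact: (is_flow_continuous_space flowP N).
have Bu : B \in unitmx.
  pose G := (fun y => cfun q (Phi (- T) (cinv p y))) \o (cfun p \o cinv cw).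
  suff /mulmx1_unit[Bu _] : B *m jacobian G ((F \o cinv q) (cfun q x)) = 1%:M.
    exact: Bu.
  apply: jacobian_inverse => //=.
    rewrite (qf _ qx) /F (pf _ pz).
    have d1 : differentiable (cfun p \o cinv cw) (cfun cw z).
      by apply: transition_differentiable => //; have [] := cwc z.
    have d2 : differentiable (fun y => cfun q (Phi (- T) (cinv p y)))
        ((cfun p \o cinv cw) (cfun cw z)).
      rewrite /= (cwf _ cwz); apply: (flow_chart_differentiable flowP) => //.
      by rewrite (flowK LF).
    exact: (differentiable_comp d1 d2).
  apply: filterS (chart_nbhs qC qx near_pw) => y [yq [yp yw]].
  by rewrite /G /F /= pf// cwf// pf// (flowK LF) qi.
(* A zero vector would contradict the strict decrease of [h] at the noncritical point [x]. *)
have X0 : X x != 0.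
  by apply/eqP => X0; have := h_decr x Cx; rewrite X0 /dfun derive0 ltxx.
have Fz (m : M) (j : 'I_n) : (cdom p (Phi T m) /\ cdom cw (Phi T m)) /\ V2 (Phi T m) ->
    stable Phi w m -> (j < morse_index h w)%N -> F m 0 j = 0.
  move=> [[pm _] Vm] mw jw; rewrite /F pf//; apply: V2z => //.
  exact: (stable_flow LF _ mw).
have near_F : \forall m \near x, (cdom p (Phi T m) /\ cdom cw (Phi T m)) /\ V2 (Phi T m).
  by apply: filterI => //; exact: (is_flow_continuous_space flowP xT).
apply: (kernel_sum_rank Au Bu (morse_index_le v) (morse_index_le w) X0).
- apply: mulmx_copid_eq0 => j vj; apply: (field_vanish (S := unstable Phi v) _ xV1 dA) => //.
    by move=> t; exact: (unstable_flow LF _ vx).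
  by move=> m Vm mv; exact: V1z.
- apply: mulmx_pid_eq0 => j jw; apply: (field_vanish (S := stable Phi w) _ near_F dB) => //.
    by move=> t; exact: (stable_flow LF _ xw).
  by move=> m Nm mw; exact: Fz.
- move=> u; have [a [b [ta tb ->]]] := transv v w Cv Cw x vx xw u.
  exists a, b; split => //.
  + apply: mulmx_copid_eq0 => j vj; apply: (tangent_vanish ta xV1 dA) => m Vm mv.
    exact: V1z.
  + apply: mulmx_pid_eq0 => j jw; apply: (tangent_vanish tb near_F dB) => m Nm mw.
    exact: Fz.
Qed.

End local_manifolds.

(** * Properness of the maps out of W-hat, and the theorem *)

Section hatW_proper.
Context {R : realType} {n : nat} {M : manifold R n}.
Variables (h : M -> R) (X : M -> 'rV[R]_n) (Phi : R -> M -> M).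
Hypotheses (flowP : is_flow X Phi) (msP : morse_smale h X Phi).
Variables (v : M) (eps del : R -> R).
Hypotheses (Cv : Crit h v) (constP : hatW_constants h eps del v).
Local Notation W := (hatWspace h Phi eps del v).
Let LF := morse_smale_lyapunov flowP msP.

Lemma hatW_compact (A : set W) (K : set R) : closed A -> compact K ->
  (forall p, A p -> K (hat_h p)) -> compact A.
Proof.
move=> clA cK AK.
have [m [_ Km]] := @compact_bounded R R^o K cK.
have {}Km s : K s -> - (m + 1) <= s <= m + 1.
  by move=> Ks; rewrite -ler_norml; apply: (Km (m + 1)) => //; rewrite ltrDl.
have slab := hatW_compact_slab LF (index_drop flowP msP) Cv constP
  (a := - (m + 1)) (b := m + 1).
by apply: subclosed_compact clA slab _ => p /AK/Km.
Qed.

Lemma hat_h_proper : proper_map (@hat_h _ _ _ h Phi v : W -> R^o).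
Proof.
move=> K cK; apply: (hatW_compact _ cK) => //.
apply: closed_comp => [p _|]; first exact: (hat_h_continuous LF).
exact: compact_closed.
Qed.

Lemma hat_i_proper : proper_map (@hat_i _ _ _ h Phi v : W -> M).
Proof.
move=> K cK.
have chK : compact (h @` K).
  apply: continuous_compact => //; apply: continuous_subspaceT => x.
  exact: (lyap_continuous LF).
apply: (hatW_compact _ chK); last by move=> p Kp; exists (hat_i p).
apply: closed_comp => [p _|]; first exact: hat_i_continuous.
exact: (compact_closed (lyap_hausdorff LF) cK).
Qed.

End hatW_proper.

Theorem theorem2p14 (R : realType) (n : nat) (M : manifold R n)
    (h : M -> R) (X : M -> 'rV[R]_n) (Phi : R -> M -> M)
    (flowP : is_flow X Phi) (msP : morse_smale h X Phi)
    (v w : M) (vcrit : Crit h v) (wcrit : Crit h w) (w_lt_v : crit_lt h w v) :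
  (forall eps : R, eps_small h (h w) (h v) eps ->
     compact [set: Bspace h Phi eps v w] /\
     hausdorff_space (Bspace h Phi eps v w)) /\
  (forall eps del : R -> R, hatW_constants h eps del v ->
     let W := hatWspace h Phi eps del v : topologicalType in
     let i : W -> M := @hat_i R n M h Phi v in
     let hh : W -> R^o := @hat_h R n M h Phi v in
     [/\ hausdorff_space W,
         continuous i /\ proper_map i,
         continuous hh /\ proper_map hh &
         compact [set: M] -> compact [set: W]]).
Proof.
have LF := morse_smale_lyapunov flowP msP; have drop := index_drop flowP msP.
split=> [eps epsP|eps del constP W i hh].
  have wv : crit_le h w v by left.
  split; first exact: (Bspace_compact LF drop vcrit wcrit wv epsP).
  exact: (Bspace_hausdorff LF vcrit wcrit wv epsP).
have i_proper : proper_map i by exact: (hat_i_proper flowP msP vcrit constP).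
split.
- exact: (hatW_hausdorff LF vcrit constP).
- by split; first exact: hat_i_continuous.
- split; first exact: (hat_h_continuous LF).
  exact: (hat_h_proper flowP msP vcrit constP).
- by move=> cM; rewrite -(preimage_setT i); exact: i_proper.
Qed.
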